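(* Let $f:\mathbb{R}^n\to\mathbb{R}$ be convex and twice continuously differentiable, and assume: (1) there is $M>0$ with $\|\nabla^2 f(x)-\nabla^2 f(y)\|\le M\|x-y\|$ for all $x,y\in\mathbb{R}^n$; (2) there is $x^*\in\mathbb{R}^n$ with $f(x^* )=f^*:=\min_{x}f(x)$; (3) there is $\kappa_H>0$ with $\|\nabla^2 f(x)\|\le\kappa_H$ for all $x\in\mathbb{R}^n$. Let $D_0=\|x_0-x^*\|$. Then the Accelerated Trust-Region Method with Local Detection (Algorithm 1 in the context), started from $x_0$, needs at most $$O\left(\epsilon_f^{-1/3}\log(1/\epsilon_g)\right)$$ calls to the $\mathrm{TR}_+$ oracle to find an $(\epsilon_f,\epsilon_g)$-approximate solution, i.e. a point $x$ with $f(x)-f^*\le\epsilon_f$ or $\|\nabla f(x)\|\le\epsilon_g$. Precisely: there are constants $C>0$ and $\bar\epsilon\in(0,1)$ depending only on $M,\kappa_H,D_0$ such that for all $\epsilon_f,\epsilon_g\in(0,\bar\epsilon)$, after at most $C\,\epsilon_f^{-1/3}\log(1/\epsilon_g)$ oracle calls Algorithm 1 (run with tolerance $\epsilon_g$) has either terminated with an output $x$ satisfying $\|\nabla f(x)\|\le\epsilon_g$, or has produced an iterate $x_k$ which is an $(\epsilon_f,\epsilon_g)$-approximate solution.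
   Context: $\|\cdot\|$ is the Euclidean norm (spectral norm for matrices); $\log$ is base $2$. $\mathrm{TR}_+$ oracle. For $x\in\mathbb{R}^n$, $\sigma\ge0$, $r\ge0$, $(d,\lambda)=\mathrm{TR}_+(x,\sigma,r)$ is the primal-dual solution of $\min_d \nabla f(x)^Td+\frac12 d^T(\nabla^2f(x)+\sigma I)d$ s.t. $\|d\|\le r$, i.e. $\|d\|\le r$, $\lambda\ge0$, $\lambda(\|d\|-r)=0$, $(\nabla^2f(x)+\sigma I+\lambda I)d=-\nabla f(x)$, $\nabla^2f(x)+\sigma I+\lambda I\succeq0$. If $\nabla f(x)=0$ take $(d,\lambda)=(0,0)$. Algorithm 1. Input $x_0=v_0\in\mathbb{R}^n$, $s_0=0$, tolerance $\epsilon_g>0$. For $k=0,1,2,\dots$: (a) $y_k=\frac{k}{k+3}x_k+\frac{3}{k+3}v_k$; (b) $\sigma_k=\frac{\sqrt{2M}}{2}\|\nabla f(y_k)\|^{1/2}$, $r_k=\frac{1}{\sqrt{2M}}\|\nabla f(y_k)\|^{1/2}$, $(d_k,\lambda_k)=\mathrm{TR}_+(y_k,\sigma_k,r_k)$, $x_{k+1}=y_k+d_k$; (c) if $\lambda_k=0$: set $(x_{k+1},\mathrm{ET})=\mathrm{LD}(y_k,\sigma_k,d_k,\epsilon_g)$, and if $\mathrm{ET}$ is True, terminate and output $x_{k+1}$; (d) $s_{k+1}=s_k+\frac{(k+1)(k+2)}{2}\nabla f(x_{k+1})$, $v_{k+1}=v_0-\sqrt{\frac{1}{24M\|s_{k+1}\|}}\,s_{k+1}$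 (with $v_{k+1}=v_0$ if $s_{k+1}=0$). Subroutine $\mathrm{LD}(y,\mu_+,d_+,\epsilon_g)$ (Local Detection). Track 0: if $\|d_+\|\le\min\{\frac{\epsilon_g}{2\kappa_H},\sqrt{\epsilon_g/M}\}$, return $(y+d_+,\text{True})$. Track 1 (local diving): $z_0=y$; for $i=1,\dots,\lceil\log(\|\nabla f(y)\|/\epsilon_g)\rceil$ (no iterations if this number is $\le0$): $z_i=z_{i-1}-\nabla^2f(z_{i-1})^{-1}\nabla f(z_{i-1})$; if $\|\nabla f(z_i)\|\le\epsilon_g$ return $(z_i,\text{True})$. If a singular Hessian is met, Track 1 is abandoned. Track 2 (ratio bracketing and bisection): if $\mu_+/\|d_+\|\le2M$ return $(y+d_+,\text{False})$. Otherwise set $r_-=\|d_+\|$, $r_+=\|(\nabla^2f(y)+M\|d_+\|I)^{-1}\nabla f(y)\|$ and repeat: $r=\frac{r_-+r_+}{2}$, $(d,\mu)=\mathrm{TR}_+(y,0,r)$; if $\mu/\|d\|<M$ set $r_+=r$; if $\mu/\|d\|>2M$ set $r_-=r$; otherwise return $(y+d,\text{False})$. Each Newton step of Track 1 (and the computation of the initial $r_+$) is counted as one oracle call, a Newton step being $\mathrm{TR}_+(\cdot,0,r)$ with $r$ sufficiently large. *)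

(* Defs.v *)
From HB Require Import structures.
From mathcomp Require Import all_boot all_order all_algebra.
From mathcomp Require Import all_classical all_reals all_analysis.

Set Implicit Arguments.
Unset Strict Implicit.
Unset Printing Implicit Defensive.

Import Order.TTheory GRing.Theory Num.Theory.
Import numFieldNormedType.Exports.

Local Open Scope classical_set_scope.
Local Open Scope ring_scope.

Section Euclidean.
Context {R : realType} {n : nat}.

(* The library norm on matrices is the maximum norm, which gives the right
   topology and differentials but not the Euclidean or spectral norm. *)
Definition enorm (v : 'cV[R]_n) : R := Num.sqrt (\sum_i v i 0 ^+ 2).

Definition specnorm (A : 'M[R]_n) : R :=
  sup [set enorm (A *m v) | v in [set v : 'cV[R]_n | enorm v <= 1]].

Definition psdmx (A : 'M[R]_n) : Prop :=
  A^T = A /\ forall v : 'cV[R]_n, 0 <= (v^T *m A *m v) 0 0.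

Definition grad (f : 'cV[R]_n -> R) (x : 'cV[R]_n) : 'cV[R]_n :=
  \col_i 'D_(delta_mx i 0) f x.

Definition hess (f : 'cV[R]_n -> R) (x : 'cV[R]_n) : 'M[R]_n :=
  \matrix_(i, j) 'D_(delta_mx i 0) (fun z => 'D_(delta_mx j 0) f z) x.

Definition twice_cont_diff (f : 'cV[R]_n -> R) : Prop :=
  [/\ forall x, differentiable f x,
      forall x, differentiable (grad f) x
    & continuous (hess f)].

End Euclidean.

Definition log2 {R : realType} (x : R) : R := ln x / ln 2.

Section Algorithm.
Context {R : realType} {n : nat}.
Implicit Types (f : 'cV[R]_n -> R) (x y z v s d : 'cV[R]_n).

Definition TR_solution f x (sigma r : R) d (lambda : R) : Prop :=
  [/\ enorm d <= r, 0 <= lambda, lambda * (enorm d - r) = 0,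
      (hess f x + sigma%:M + lambda%:M) *m d = - grad f x
    & psdmx (hess f x + sigma%:M + lambda%:M)].

(* When r = 0 and the gradient is nonzero, no primal-dual solution exists, so
   nothing can be required of the oracle there; the algorithm never makes such
   a call. For sigma = 0 the primal solution may fail to be unique: the oracle
   may then return any of them. *)
Definition TR_oracle f (TR : 'cV[R]_n -> R -> R -> 'cV[R]_n * R) : Prop :=
  forall x (sigma r : R), 0 <= sigma -> 0 <= r ->
    if grad f x == 0 then TR x sigma r = (0, 0)
    else 0 < r -> TR_solution f x sigma r (TR x sigma r).1 (TR x sigma r).2.

Variables (f : 'cV[R]_n -> R) (TR : 'cV[R]_n -> R -> R -> 'cV[R]_n * R).
Variables (M kappaH eps_g : R).

(* At most m Newton steps from z. The result is the returned point (None if the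
   track ends without one) and the number of oracle calls; the call that
   reveals a singular Hessian is counted. *)
Fixpoint local_diving (m : nat) z : option 'cV[R]_n * nat :=
  if m is m'.+1 then
    if hess f z \in unitmx then
      let z' := z - invmx (hess f z) *m grad f z in
      if enorm (grad f z') <= eps_g then (Some z', 1%N)
      else let: (o, c) := local_diving m' z' in (o, c.+1)
    else (None, 1%N)
  else (None, 0%N).

Definition diving_steps y : nat :=
  `|Num.max 0%R (Num.ceil (log2 (enorm (grad f y) / eps_g))%R)|%N.

(* [bisection y rm rp x c]: started from the bracket (rm, rp), the bisection
   stops, with result x, after c oracle calls. It is an inductive relation, so
   a non-terminating bisection has no result. *)
Inductive bisection y : R -> R -> 'cV[R]_n -> nat -> Prop :=
| bisection_stop (rm rp : R) d (mu : R) :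
    (d, mu) = TR y 0 ((rm + rp) / 2) ->
    M <= mu / enorm d <= 2 * M ->
    bisection y rm rp (y + d) 1
| bisection_upper (rm rp : R) d (mu : R) x c :
    (d, mu) = TR y 0 ((rm + rp) / 2) ->
    mu / enorm d < M ->
    bisection y rm ((rm + rp) / 2) x c ->
    bisection y rm rp x c.+1
| bisection_lower (rm rp : R) d (mu : R) x c :
    (d, mu) = TR y 0 ((rm + rp) / 2) ->
    2 * M < mu / enorm d ->
    bisection y ((rm + rp) / 2) rp x c ->
    bisection y rm rp x c.+1.

(* [local_detection y mu d x et c]: LD(y, mu, d, eps_g) returns (x, et) after c
   oracle calls. In c1 + 1 + c2, the 1 is the computation of the initial r_+. *)
Definition local_detection y (mu : R) d x (et : bool) (c : nat) : Prop :=
  if enorm d <= Num.min (eps_g / (2 * kappaH)) (Num.sqrt (eps_g / M)) then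
    (x, et, c) = (y + d, true, 0%N)
  else match local_diving (diving_steps y) y with
  | (Some z, c1) => (x, et, c) = (z, true, c1)
  | (None, c1) =>
      if mu / enorm d <= 2 * M then (x, et, c) = (y + d, false, c1)
      else
        let rp := enorm (invmx (hess f y + (M * enorm d)%:M) *m grad f y) in
        exists2 c2, bisection y (enorm d) rp x c2
                  & (et, c) = (false, (c1 + 1 + c2)%N)
  end.

(* [iteration k x v x' et c]: iteration k, entered with x_k = x and v_k = v,
   yields x_{k+1} = x' after c oracle calls; et tells whether it terminates. *)
Definition iteration (k : nat) x v x' (et : bool) (c : nat) : Prop :=
  let y := (k%:R / (k + 3)%:R) *: x + (3 / (k + 3)%:R) *: v in
  let sigma := Num.sqrt (2 * M) / 2 * Num.sqrt (enorm (grad f y)) in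
  let r := 1 / Num.sqrt (2 * M) * Num.sqrt (enorm (grad f y)) in
  let: (d, lambda) := TR y sigma r in
  if lambda == 0 then
    exists2 c', local_detection y sigma d x' et c' & c = c'.+1
  else (x', et, c) = (y + d, false, 1%N).

(* [produces x0 k x v s c]: started from x0, the algorithm completes iterations
   0, ..., k - 1 without terminating, using c oracle calls in all, and
   (x_k, v_k, s_k) = (x, v, s). For s_{k+1} = 0 the formula gives v_{k+1} = v_0
   as it should, the scalar being irrelevant. *)
Inductive produces x0 :
  nat -> 'cV[R]_n -> 'cV[R]_n -> 'cV[R]_n -> nat -> Prop :=
| produces_init : produces x0 0 x0 x0 0 0
| produces_step k x v s c x' c' :
    produces x0 k x v s c ->
    iteration k x v x' false c' ->
    let s' := s + (((k + 1) * (k + 2))%:R / 2) *: grad f x' in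
    let v' := x0 - Num.sqrt (1 / (24 * M * enorm s')) *: s' in
    produces x0 k.+1 x' v' s' (c + c').

Definition outputs x0 x (c : nat) : Prop :=
  exists k xk vk sk ck c',
    [/\ produces x0 k xk vk sk ck, iteration k xk vk x true c'
      & c = (ck + c')%N].

End Algorithm.

Definition approx_solution {R : realType} {n : nat} (f : 'cV[R]_n -> R)
    (fmin eps_f eps_g : R) (x : 'cV[R]_n) : Prop :=
  f x - fmin <= eps_f \/ enorm (grad f x) <= eps_g.

(* Main.v *)
Require Import Defs.
From HB Require Import structures.
From mathcomp Require Import all_boot all_order all_algebra.
From mathcomp Require Import all_classical all_reals all_analysis.
From mathcomp Require Import ring lra.

Import Order.TTheory GRing.Theory Num.Theory.
Import numFieldNormedType.Exports.

Local Open Scope classical_set_scope.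
Local Open Scope ring_scope.

(** Every non-terminating iteration moves from y to x' = y + d with
    (H + mu I) d = - grad f y and M |d| <= mu <= 2 M |d|. Since the Hessian is
    M-Lipschitz, |grad f x' + mu d| <= M |d|^2 / 2, which makes
    <grad f x', y - x'> at least a multiple of |grad f x'|^(3/2) / sqrt M. This is
    what the estimate sequence with the regularizer 8 M |z - x0|^3 (uniformly
    convex of degree 3) needs, so that A_k (f x_k - min f) <= 8 M D0^3 with
    A_k = k (k + 1) (k + 2) / 6, and O(eps_f^(-1/3)) iterations suffice.

    One iteration costs O(log (1 / eps_g)). The function gap, hence the gradient,
    is uniformly bounded at the points y_k, which bounds the number of Newton
    steps. If Track 0 fails, then |d+| is at least a multiple of eps_g. When
    (H + mu1) d1 = (H + mu2) d2 = - grad f y with mu1 > 2 M |d1| and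
    mu2 <= M |d2|, we have (H + mu2) (d2 - d1) = (mu1 - mu2) d1, and the
    cocoercivity of the psd matrix H + mu2 separates |d1| from |d2| by a multiple
    of eps_g^3. Every bracket met by the bisection is thus at least that wide,
    while the first one is O(1 / eps_g) wide. The success of Track 1 is not needed
    for this bound. *)

(** * Euclidean and spectral norms *)

(* Locked, because unification would otherwise unfold failed matches. *)
HB.lock Definition dot {R : realType} {n : nat} (u v : 'cV[R]_n) : R :=
  \sum_i u i 0 * v i 0.
Canonical dot_unlockable := Unlockable dot.unlock.

Section EuclideanTheory.
Context {R : realType} {n : nat}.
Implicit Types (u v w : 'cV[R]_n) (A : 'M[R]_n) (a t : R).

Lemma ler_of_sqr (x y : R) : 0 <= y -> x ^+ 2 <= y ^+ 2 -> x <= y.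
Proof. by move=> y0; case: (leP x y) => // yx; nra. Qed.

Lemma dot_sum u v : dot u v = \sum_i u i 0 * v i 0.
Proof. by rewrite dot.unlock. Qed.

Lemma dotC u v : dot u v = dot v u.
Proof. by rewrite !dot_sum; apply: eq_bigr => i _; rewrite mulrC. Qed.

Lemma dotDl u v w : dot (u + v) w = dot u w + dot v w.
Proof. by rewrite !dot_sum -big_split; apply: eq_bigr => i _; rewrite !mxE mulrDl. Qed.

Lemma dotZl a u v : dot (a *: u) v = a * dot u v.
Proof. by rewrite !dot_sum big_distrr; apply: eq_bigr => i _; rewrite !mxE /= mulrA. Qed.

Lemma dotNl u v : dot (- u) v = - dot u v.
Proof. by rewrite -scaleN1r dotZl mulN1r. Qed.

Lemma dotDr u v w : dot u (v + w) = dot u v + dot u w.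
Proof. by rewrite dotC dotDl !(dotC u). Qed.

Lemma dotZr a u v : dot u (a *: v) = a * dot u v.
Proof. by rewrite dotC dotZl dotC. Qed.

Lemma dotNr u v : dot u (- v) = - dot u v.
Proof. by rewrite dotC dotNl dotC. Qed.

Lemma dot0l u : dot 0 u = 0.
Proof. by rewrite -(scale0r 0) dotZl mul0r. Qed.

Lemma dot0r u : dot u 0 = 0.
Proof. by rewrite dotC dot0l. Qed.

Definition dotE := (dotDl, dotDr, dotZl, dotZr, dotNl, dotNr, dot0l, dot0r).

Lemma dot_trmx A u v : dot u (A *m v) = dot (A^T *m u) v.
Proof.
rewrite !dot_sum (eq_bigr (fun i => \sum_j u i 0 * (A i j * v j 0))) => [|i _].
  rewrite exchange_big; apply: eq_bigr => j _.
  rewrite mxE big_distrl; apply: eq_bigr => i _.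
  by rewrite mxE /=; ring.
by rewrite mxE big_distrr.
Qed.

Lemma dot_ge0 v : 0 <= dot v v.
Proof. by rewrite dot_sum; apply: sumr_ge0 => i _; rewrite -expr2 sqr_ge0. Qed.

Lemma enormE v : enorm v = Num.sqrt (dot v v).
Proof. by rewrite dot_sum; congr Num.sqrt; apply: eq_bigr => i _; rewrite expr2. Qed.

Lemma sqr_enorm v : enorm v ^+ 2 = dot v v.
Proof. by rewrite enormE sqr_sqrtr ?dot_ge0. Qed.

Lemma enorm_ge0 v : 0 <= enorm v.
Proof. exact: sqrtr_ge0. Qed.

Lemma enorm0 : enorm (0 : 'cV[R]_n) = 0.
Proof. by rewrite enormE dot0l sqrtr0. Qed.

Lemma enorm_eq0 v : (enorm v == 0) = (v == 0).
Proof.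
apply/eqP/eqP => [v0|->]; last exact: enorm0.
have : dot v v = 0 by rewrite -sqr_enorm v0 expr0n.
move/eqP; rewrite dot_sum psumr_eq0 => [/allP h|i _]; last by rewrite -expr2 sqr_ge0.
apply/matrixP => i j; rewrite ord1 mxE.
by have := h i (mem_index_enum _); rewrite mulf_eq0 orbb => /eqP.
Qed.

Lemma enormZ a v : enorm (a *: v) = `|a| * enorm v.
Proof.
by rewrite !enormE !dotE mulrA -expr2 sqrtrM ?sqr_ge0 // sqrtr_sqr.
Qed.

Lemma enormN v : enorm (- v) = enorm v.
Proof. by rewrite -scaleN1r enormZ normrN1 mul1r. Qed.

Lemma enormB u v : enorm (u - v) = enorm (v - u).
Proof. by rewrite -enormN opprB. Qed.

(** Cauchy-Schwarz, from [0 <= |w|^2] with [w = |u|^2 v - <u, v> u]. *)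
Lemma dot_le u v : dot u v <= enorm u * enorm v.
Proof.
have [/eqP|u0] := boolP (enorm u == 0).
  by move=> /eqP; rewrite enorm_eq0 => /eqP ->; rewrite dot0l enorm0 mul0r.
have {}u0 : 0 < enorm u by rewrite lt_neqAle eq_sym u0 enorm_ge0.
have := dot_ge0 (enorm u ^+ 2 *: v - dot u v *: u).
rewrite !dotE -!sqr_enorm (dotC v u) => h.
have {h} : 0 <= enorm u ^+ 2 * ((enorm u * enorm v) ^+ 2 - dot u v ^+ 2).
  by apply: le_trans h _; rewrite le_eqVlt; apply/orP; left; apply/eqP; ring.
rewrite pmulr_rge0 ?exprn_gt0 // subr_ge0; apply: ler_of_sqr.
by rewrite mulr_ge0 ?enorm_ge0.
Qed.

Lemma dot_abs_le u v : `|dot u v| <= enorm u * enorm v.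
Proof. by rewrite ler_norml dot_le andbT lerNl -dotNl -(enormN u) dot_le. Qed.

Lemma enormD u v : enorm (u + v) <= enorm u + enorm v.
Proof.
apply: ler_of_sqr; first by rewrite addr_ge0 ?enorm_ge0.
rewrite sqr_enorm !dotE -!sqr_enorm.
by rewrite (dotC v u); have := dot_le u v; nra.
Qed.

Lemma enorm_le_dot w a : 0 <= a -> dot w w <= a * enorm w -> enorm w <= a.
Proof.
move=> a0; rewrite -sqr_enorm.
have := enorm_ge0 w; rewrite le_eqVlt => /orP[/eqP <- //|w0].
by rewrite expr2 ler_pM2r.
Qed.

(** [a] is the Frobenius norm, by Cauchy-Schwarz on each row. It bounds the set in [specnorm], so
    that its [sup] is a true upper bound. *)
Lemma enorm_mulmx_bounded A :
  exists2 a, 0 <= a & forall v, enorm (A *m v) <= a * enorm v.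
Proof.
pose r i := (row i A)^T.
pose S := \sum_i enorm (r i) ^+ 2.
have S0 : 0 <= S by apply: sumr_ge0 => i _; rewrite sqr_ge0.
exists (Num.sqrt S); first exact: sqrtr_ge0.
move=> v; apply: ler_of_sqr; first by rewrite mulr_ge0 ?sqrtr_ge0 ?enorm_ge0.
rewrite sqr_enorm exprMn sqr_sqrtr // dot_sum.
rewrite big_distrl; apply: ler_sum => i _ /=.
have -> : (A *m v) i 0 = dot (r i) v.
  by rewrite dot_sum mxE; apply: eq_bigr => j _; rewrite !mxE.
rewrite -expr2 -exprMn -(real_normK (num_real (dot _ _))).
by rewrite lerXn2r ?nnegrE ?mulr_ge0 ?enorm_ge0 ?dot_abs_le.
Qed.

Lemma enorm_mulmx A v : enorm (A *m v) <= specnorm A * enorm v.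
Proof.
have [/eqP|v0] := boolP (enorm v == 0).
  move=> /eqP; rewrite enorm_eq0 => /eqP ->.
  by rewrite mulmx0 enorm0 mulr0.
have {}v0 : 0 < enorm v by rewrite lt_neqAle eq_sym v0 enorm_ge0.
have h : enorm (A *m ((enorm v)^-1 *: v)) <= specnorm A.
  apply: sup_ubound; last first.
    exists ((enorm v)^-1 *: v) => //=.
    by rewrite enormZ ger0_norm ?invr_ge0 ?enorm_ge0 // mulVf ?gt_eqF.
  have [a a0 ha] := enorm_mulmx_bounded A.
  exists a => _ [w /= w1 <-]; apply: le_trans (ha w) _.
  by rewrite -[leRHS]mulr1 ler_wpM2l.
by move: h; rewrite -scalemxAr enormZ ger0_norm ?invr_ge0 ?enorm_ge0 // mulrC ler_pdivrMr.
Qed.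

Lemma dot_mulmx_le A u v L :
  specnorm A <= L -> dot u (A *m v) <= L * enorm u * enorm v.
Proof.
move=> AL; apply: le_trans (dot_le _ _) _.
rewrite (mulrC L) -mulrA ler_wpM2l ?enorm_ge0 //.
by apply: le_trans (enorm_mulmx _ _) _; rewrite ler_wpM2r ?enorm_ge0.
Qed.

Lemma dot_mulmx_leB A B u v L : specnorm (A - B) <= L ->
  dot u (A *m v) <= dot u (B *m v) + L * enorm u * enorm v.
Proof. by move=> /(dot_mulmx_le _ u v); rewrite mulmxBl dotDr dotNr lerBlDl. Qed.

(* Cauchy-Schwarz for the semi-inner product (u, v) |-> <u, P v>, at u = w and
   v = P w. *)
Lemma psd_coercive (P : 'M[R]_n) w (L : R) :
  P^T = P -> (forall v, 0 <= dot v (P *m v)) ->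
  (forall v, dot v (P *m v) <= L * enorm v ^+ 2) ->
  enorm (P *m w) ^+ 2 <= L * dot w (P *m w).
Proof.
move=> PT Ppos PL; set z := P *m w.
have sym u v : dot u (P *m v) = dot v (P *m u) by rewrite dot_trmx PT dotC.
have q (t : R) : 0 <= dot w z - 2 * t * enorm z ^+ 2 + t ^+ 2 * dot z (P *m z).
  have := Ppos (w - t *: z); rewrite mulmxBr -scalemxAr !dotE -!/z (sym w z).
  rewrite -/z sqr_enorm => h; apply: le_trans h _.
  by rewrite le_eqVlt; apply/orP; left; apply/eqP; ring.
have z0 := sqr_ge0 (enorm z).
have {}q (t : R) : 2 * t * enorm z ^+ 2 <= dot w z + t ^+ 2 * L * enorm z ^+ 2.
  by have := q t; have := PL z; have := sqr_ge0 t; nra.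
have wz := Ppos w; rewrite -/z in wz.
(* For [L > 0] the best choice is [t = L^-1]. For [L <= 0] the form vanishes at [w], and [t = 1]
   then gives [z = 0]. *)
have [L0|L0] := leP L 0.
  have wz' : dot w z = 0.
    by have := PL w; have := sqr_ge0 (enorm w); rewrite -/z; nra.
  have := q 1; have := q (1 - L); rewrite wz' mulr0 => *; nra.
have := q L^-1; rewrite -(ler_pM2l L0) => h.
have e1 : L * (2 * L^-1 * enorm z ^+ 2) = 2 * enorm z ^+ 2.
  by field; rewrite gt_eqF.
have e2 : L * (dot w z + L^-1 ^+ 2 * L * enorm z ^+ 2) = L * dot w z + enorm z ^+ 2.
  by field; rewrite gt_eqF.
by rewrite e1 e2 in h; lra.
Qed.

End EuclideanTheory.

(** * Second order calculus *)

Section Line.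
Context {R : realType}.

Lemma is_derive_line {V W : normedModType R} (h : V -> W) (y d : V) (t : R) :
  derivable h (y + t *: d) d ->
  is_derive t (1 : R) (fun s : R => h (y + s *: d)) ('D_d h (y + t *: d)).
Proof.
have E : (fun k : R => k^-1 *: (h (y + (k *: (1 : R) + t) *: d) - h (y + t *: d))) =
         (fun k : R => k^-1 *: (h (k *: d + (y + t *: d)) - h (y + t *: d))).
  apply/funext => k; congr (_ *: (h _ - _)).
  by rewrite scalerDl [k *: 1]mulr1 addrCA.
by move=> hd; split; rewrite /derivable /derive /= E.
Qed.

(** The derivative exists, so its limit may be taken along small [t > 0] only, the side on which
    convexity speaks. *)
Lemma derive_le_right {V : normedModType R} (h : V -> R) (x v : V) (c : R) :
  derivable h x v ->
  (forall t : R, 0 < t < 1 -> h (t *: v + x) - h x <= t * c) -> 'D_v h x <= c.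
Proof.
move=> hd hc; rewrite leNgt; apply/negP => cD.
have e0 : 0 < 'D_v h x - c by rewrite subr_gt0.
move/cvgrPdist_lt : hd => /(_ _ e0); rewrite near_withinE => /nbhs_ballP[e /= e1 He].
pose t : R := Num.min (e / 2) (1 / 2).
have t0 : 0 < t by rewrite lt_min !divr_gt0.
have te : t < e by rewrite gt_min; apply/orP; left; lra.
have t1 : t < 1 by rewrite gt_min; apply/orP; right; lra.
have /(_ _ _)/= := He t; rewrite /ball /= sub0r normrN gtr0_norm // => /(_ te).
move=> /(_ (lt0r_neq0 t0)).
have := hc t; rewrite t0 t1 => /(_ isT) h1.
have : t^-1 * (h (t *: v + x) - h x) <= c.
  by rewrite mulrC ler_pdivrMr // mulrC.
rewrite /derive /GRing.scale /= => h2 /ltr_distlBl.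
by rewrite -/(derive h x v); rewrite /derive /GRing.scale /= in h2 *; lra.
Qed.

(** The mean value theorem for [p] minus the quadratic with derivative [c0 + c1 t] gives the factor
    1/2 of Taylor estimates without integrals. *)
Lemma increment_le (p dp : R -> R) (c0 c1 : R) :
  (forall t : R, is_derive t (1 : R) p (dp t)) ->
  (forall t, 0 <= t <= 1 -> dp t <= c0 + c1 * t) ->
  p 1 - p 0 <= c0 + c1 / 2.
Proof.
move=> pd dple.
pose q t := p t - (c0 * t + c1 / 2 * t ^+ 2).
have qd t : is_derive t (1 : R) q (dp t - (c0 + c1 * t)).
  rewrite /q; apply: is_derive_eq.
  by rewrite /GRing.scale /=; field.
have qc : {within `[0, 1], continuous q}.
  by apply: derivable_within_continuous => t _; exact: (@ex_derive _ _ _ _ _ _ _ (qd t)).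
have [t] := @MVT R q _ 0 1 ltr01 (fun t _ => qd t) qc.
rewrite in_itv /= => /andP[t0 t1]; rewrite /q.
by have := dple t; rewrite (ltW t0) (ltW t1) => /(_ isT); lra.
Qed.

End Line.

Section Calculus.
Context {R : realType} {n : nat} (f : 'cV[R]_n -> R).
Implicit Types (x y v w d : 'cV[R]_n).

Lemma dot_gradE x d : differentiable f x -> 'D_d f x = dot (grad f x) d.
Proof.
move=> fd; rewrite deriveE // {1}(matrix_sum_delta d) raddf_sum dot_sum.
apply: eq_bigr => i _; by rewrite big_ord1 /= linearZ /= mxE deriveE // mulrC.
Qed.

Hypotheses (f_diff : forall x, differentiable f x)
           (grad_diff : forall x, differentiable (grad f) x).

(** [hess] has the outer derivative in its row index, so the Jacobian of the gradient is its
    transpose; hence the order of [d] and [w]. Symmetry comes later, from the oracle. *)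
Lemma is_derive_dot_grad w x d :
  is_derive x d (fun z => dot w (grad f z)) (dot d (hess f x *m w)).
Proof.
have -> : dot d (hess f x *m w) = dot w ((hess f x)^T *m d).
  by rewrite dot_trmx dotC.
have cd j : differentiable (fun z => grad f z j 0) x.
  apply: (@differentiable_comp _ _ _ _ (grad f) (fun N : 'cV[R]_n => N j 0 : R)) => //.
  exact: differentiable_coord.
have e1 : (fun z => dot w (grad f z)) =
    \sum_(j < n) ((w j 0) \*: (fun z => grad f z j 0 : R)).
  by apply/funext => z; rewrite fct_sumE dot_sum.
rewrite e1.
have cD j : is_derive x d (fun z => grad f z j 0) ('D_d (fun z => grad f z j 0) x).
  exact/derivableP/diff_derivable.
apply: (@is_derive_eq _ _ _ _ _ _ _ _ (is_derive_sum (fun j => is_deriveZ (w j 0) (cD j)))).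
rewrite dot_sum; apply: eq_bigr => j _; congr (_ * _).
rewrite deriveE // {1}(matrix_sum_delta d) raddf_sum mxE.
apply: eq_bigr => i _; rewrite big_ord1 /= linearZ /= -deriveE // !mxE mulrC.
by congr (_ * _); congr ('D_ _ _ _); apply/funext => z; rewrite mxE.
Qed.

Lemma is_derive_dot_grad_line w x d (t : R) :
  is_derive t (1 : R) (fun s : R => dot w (grad f (x + s *: d)))
    (dot d (hess f (x + t *: d) *m w)).
Proof.
have H := is_derive_dot_grad w (x + t *: d) d.
have D := is_derive_line (fun z => dot w (grad f z)) x d t (@ex_derive _ _ _ _ _ _ _ H).
by rewrite derive_val in D.
Qed.

Lemma is_derive_line_grad x d (t : R) :
  is_derive t (1 : R) (fun s : R => f (x + s *: d)) (dot (grad f (x + t *: d)) d).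
Proof.
rewrite -dot_gradE //; apply: is_derive_line; exact: diff_derivable.
Qed.

Lemma grad_taylor_dot M w x d :
  (forall x y, specnorm (hess f x - hess f y) <= M * enorm (x - y)) -> 0 <= M ->
  dot w (grad f (x + d)) - dot w (grad f x) <=
    dot d (hess f x *m w) + M * enorm d ^+ 2 * enorm w / 2.
Proof.
move=> lip M0.
have H t : 0 <= t <= 1 -> dot d (hess f (x + t *: d) *m w) <=
    dot d (hess f x *m w) + M * enorm d ^+ 2 * enorm w * t.
  case/andP=> t0 _.
  apply: le_trans (dot_mulmx_leB _ _ _ _ _ (lip _ _)) _. apply: lerD => //.
  by rewrite [x + _]addrC addrK enormZ ger0_norm // le_eqVlt; apply/orP; left;
     apply/eqP; ring.
have := @increment_le R _ _ _ _ (is_derive_dot_grad_line w x d) H.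
by rewrite scale1r scale0r addr0.
Qed.

(** The scalar estimate is tested against the remainder itself. *)
Lemma grad_taylor M x d : 0 <= M ->
  (forall x y, specnorm (hess f x - hess f y) <= M * enorm (x - y)) ->
  enorm (grad f (x + d) - grad f x - (hess f x)^T *m d) <= M / 2 * enorm d ^+ 2.
Proof.
move=> M0 lip.
apply: enorm_le_dot; first by rewrite mulr_ge0 ?divr_ge0 ?sqr_ge0.
have := fun w => @grad_taylor_dot M w x d lip M0.
move: (grad f (x + d)) (grad f x) (enorm d) => u v e /(_ (u - v - (hess f x)^T *m d)).
rewrite [dot d (_ *m _)]dot_trmx [dot (_ *m d) _]dotC.
move: (_ *m d) => z.
have -> : dot (u - v - z) (u - v - z) =
  dot (u - v - z) u - dot (u - v - z) v - dot (u - v - z) z by rewrite !(dotDr, dotNr).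
by move: (dot _ u) (dot _ v) (dot _ z) (enorm _) => *; lra.
Qed.

(** The Hessian bound is integrated twice: from [x] to [x + t d] for the slope at [t], then over
    [t]. *)
Lemma descent kappa x d :
  (forall x, specnorm (hess f x) <= kappa) ->
  f (x + d) <= f x + dot (grad f x) d + kappa / 2 * enorm d ^+ 2.
Proof.
move=> hb.
have gle t : 0 <= t <= 1 ->
    dot (grad f (x + t *: d)) d <= dot (grad f x) d + kappa * enorm d ^+ 2 * t.
  case/andP=> t0 t1.
  have D s := is_derive_dot_grad_line d x (t *: d) s.
  have := @increment_le R _ _ (t * (kappa * enorm d ^+ 2)) 0 D.
  rewrite scale1r scale0r addr0 !(dotC d) mul0r addr0 => H.
  rewrite -lerBlDl; apply: le_trans (H _) _; last by rewrite mulrC.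
  move=> s _; rewrite mul0r addr0 dotZl ler_wpM2l //.
  by rewrite expr2 mulrA dot_mulmx_le.
have := @increment_le R _ _ (dot (grad f x) d) (kappa * enorm d ^+ 2)
  (is_derive_line_grad x d) gle.
by rewrite scale1r scale0r addr0; lra.
Qed.

(** * Consequences of a global minimum *)

Section Minimum.
Variables (kappa : R) (xstar : 'cV[R]_n).
Hypotheses (kappa_gt0 : 0 < kappa)
  (hess_bound : forall x, specnorm (hess f x) <= kappa)
  (xstar_min : forall x, f xstar <= f x).

(** A gradient step with step size [1 / kappa] cannot go below the minimum. *)
Lemma sqr_enorm_grad_le x : enorm (grad f x) ^+ 2 <= 2 * kappa * (f x - f xstar).
Proof.
have := le_trans (xstar_min _) (descent kappa x (- kappa^-1 *: grad f x) hess_bound).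
rewrite dotZr -sqr_enorm enormZ normrN gtr0_norm ?invr_gt0 // => h.
set g := enorm _ in h *.
have e : kappa / 2 * (kappa^-1 * g) ^+ 2 = kappa^-1 / 2 * g ^+ 2.
  by field; rewrite gt_eqF.
rewrite {}e in h.
have {}h : kappa^-1 * g ^+ 2 <= 2 * (f x - f xstar) by lra.
by move: h; rewrite mulrC ler_pdivrMr // mulrAC.
Qed.

Lemma grad_min : grad f xstar = 0.
Proof.
apply/eqP; rewrite -enorm_eq0 -(sqrf_eq0 (enorm _)) eq_le sqr_ge0 andbT.
by have := sqr_enorm_grad_le xstar; rewrite subrr mulr0.
Qed.

Lemma min_gap_le x : f x - f xstar <= kappa / 2 * enorm (x - xstar) ^+ 2.
Proof.
have := descent kappa xstar (x - xstar) hess_bound.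
by rewrite grad_min dot0l addr0 [xstar + _]addrC subrK lerBlDl.
Qed.

End Minimum.

(** * Convexity to first and second order *)

Section Convex.
Hypothesis f_convex : convex_function [set: convex_lmodType 'cV[R]_n] f.

Lemma convex_le x y (t : R) : 0 <= t <= 1 ->
  f (t *: x + (1 - t) *: y) <= t * f x + (1 - t) * f y.
Proof.
case/andP=> t0 t1.
have t01 : Itv.spec (@Itv.num_sem R) (Itv.Real `[0%Z, 1%Z]) t.
  by rewrite /Itv.spec /= /Itv.num_sem num_real /= in_itv /= t0 t1.
have := @f_convex (Itv.mk t01) x y; rewrite !in_setT => /(_ isT isT).
by [].
Qed.

(** The difference quotients from [x] towards [y] are at most [f y - f x]. *)
Lemma convex_grad x y : f x + dot (grad f x) (y - x) <= f y.
Proof.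
rewrite addrC -lerBrDr -dot_gradE //.
apply: derive_le_right => [|t /andP[t0 t1]]; first exact: diff_derivable.
have -> : t *: (y - x) + x = t *: y + (1 - t) *: x.
  by rewrite scalerBr scalerBl scale1r addrAC addrA addrAC.
by have := @convex_le y x t; rewrite (ltW t0) (ltW t1) => /(_ isT); lra.
Qed.

(** Adding the tangent inequalities at both ends shows that the gradient is monotone. Pairing it
    with [- v] turns this into the upper bound that [derive_le_right] needs. *)
Lemma hess_psd x v : 0 <= dot v (hess f x *m v).
Proof.
have H := is_derive_dot_grad (- v) x v.
rewrite -oppr_le0 -dotNr -mulmxN.
have <- := @derive_val _ _ _ _ _ _ _ H.
apply: derive_le_right => [|t /andP[t0 t1]]; first exact: ex_derive.
rewrite mulr0 !dotNl.
have h1 := convex_grad x (t *: v + x); have h2 := convex_grad (t *: v + x) x.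
rewrite addrK opprD addrCA subrr addr0 !(dotNr, dotZr) in h1 h2.
rewrite !(dotC v); nra.
Qed.

End Convex.

End Calculus.

(** * The estimate sequence *)

Section Acceleration.
Context {R : realType} {n : nat}.
Implicit Types (x y v w d g s : 'cV[R]_n).

(** [a], [b], [t] are the sides of a triangle. The cubic increases in [t] up to [2 a] and decreases
    afterwards, so it is compared with its value at [|a - b|] or at [a + b]. *)
Lemma cubic_convex_scalar (a b t : R) : 0 <= a -> 0 <= b -> 0 <= t ->
  `|a - b| <= t -> t <= a + b ->
  0 <= 2 * b ^+ 3 + a ^+ 3 - 3 * a * b ^+ 2 + 3 * a * t ^+ 2 - t ^+ 3.
Proof.
move=> a0 b0 t0 tl tu.
set P := _ - t ^+ 3.
have [ta|ta] := leP t (2 * a).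
  have [ab|ab] := leP a b.
    rewrite distrC ger0_norm ?subr_ge0 // in tl.
    have -> : P = (b - a) ^+ 2 * (b + 5 * a)
      + (t - (b - a)) * (3 * a * (t + (b - a)) - (t ^+ 2 + t * (b - a) + (b - a) ^+ 2)).
      by rewrite /P; ring.
    apply: addr_ge0; first by rewrite mulr_ge0 ?sqr_ge0 //; lra.
    by apply: mulr_ge0; nra.
  rewrite ger0_norm ?subr_ge0 ?(ltW ab) // in tl.
  have -> : P = 3 * (a + b) * (a - b) ^+ 2
    + (t - (a - b)) * (3 * a * (t + (a - b)) - (t ^+ 2 + t * (a - b) + (a - b) ^+ 2)).
    by rewrite /P; ring.
  apply: addr_ge0; first by rewrite mulr_ge0 ?sqr_ge0 //; lra.
  by apply: mulr_ge0; nra.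
have -> : P = (b ^+ 3 + 3 * a * (a ^+ 2 + a * b - b ^+ 2))
  + (a + b - t) * ((a + b) ^+ 2 + (a + b) * t + t ^+ 2 - 3 * a * (a + b + t)).
  by rewrite /P; ring.
apply: addr_ge0; last by apply: mulr_ge0; nra.
have -> : b ^+ 3 + 3 * a * (a ^+ 2 + a * b - b ^+ 2) =
  b * (b - 3 / 2 * a) ^+ 2 + 3 / 4 * a ^+ 2 * b + 3 * a ^+ 3 by field.
have h1 : 0 <= b * (b - 3 / 2 * a) ^+ 2 by rewrite mulr_ge0 ?sqr_ge0.
have h2 : 0 <= a ^+ 2 * b by rewrite mulr_ge0 ?sqr_ge0.
have h3 : 0 <= a ^+ 3 by rewrite exprn_ge0.
by lra.
Qed.

(** The law of cosines removes the inner product, so that only three lengths remain. Note that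
    [|x| x] is the gradient of [|x|^3 / 3]. *)
Lemma cubic_uniformly_convex x y :
  enorm x ^+ 3 / 3 + enorm x * dot x (y - x) + enorm (y - x) ^+ 3 / 6
  <= enorm y ^+ 3 / 3.
Proof.
have tl : `|enorm x - enorm y| <= enorm (y - x).
  rewrite ler_norml; have := enormD (y - x) x; have := enormD (x - y) y.
  by rewrite !subrK (enormB x y) => h1 h2; apply/andP; split; lra.
have tu : enorm (y - x) <= enorm x + enorm y.
  by have := enormD y (- x); rewrite enormN; lra.
have := @cubic_convex_scalar _ _ _ (enorm_ge0 _) (enorm_ge0 _) (enorm_ge0 _) tl tu.
have -> : dot x (y - x) = (enorm y ^+ 2 - enorm x ^+ 2 - enorm (y - x) ^+ 2) / 2.
  by rewrite !sqr_enorm !dotE (dotC y x); field.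
set a := enorm x; set b := enorm y; set t := enorm _ => h.
rewrite -subr_ge0; apply: le_trans (_ : 0 <= (2 * b ^+ 3 + a ^+ 3 - 3 * a * b ^+ 2
  + 3 * a * t ^+ 2 - t ^+ 3) / 6) _; first by rewrite divr_ge0.
by rewrite le_eqVlt; apply/orP; left; apply/eqP; field.
Qed.

(* Expanding the square of [|g + mu d| <= M/2 |d|^2] bounds [- <g, d>] from
   below; tau stands for sqrt (|g| / (24 M)), the natural scale of the estimate
   sequence. *)
Lemma regularized_step_decrease (M mu tau : R) g d :
  0 < M -> d != 0 -> M * enorm d <= mu -> mu <= 2 * M * enorm d ->
  enorm (g + mu *: d) <= M / 2 * enorm d ^+ 2 ->
  0 <= tau -> enorm g = 24 * M * tau ^+ 2 ->
  2 * enorm g * tau <= - dot g d.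
Proof.
move=> M0 d0 mul muu res tau0 gE.
have r0 : 0 < enorm d by rewrite lt_neqAle eq_sym enorm_eq0 d0 enorm_ge0.
have mu0 : 0 < mu by apply: lt_le_trans mul; rewrite mulr_gt0.
have {res} : enorm (g + mu *: d) ^+ 2 <= (M / 2 * enorm d ^+ 2) ^+ 2.
  by rewrite lerXn2r ?nnegrE ?enorm_ge0 // mulr_ge0 ?sqr_ge0 // divr_ge0 ?ltW.
rewrite sqr_enorm !dotE -!sqr_enorm (dotC d g) gE.
move: r0 mul muu; set r := enorm d; set D := dot g d => r0 mul muu h.
have q0 : M ^+ 2 * r ^+ 2 <= mu ^+ 2.
  by rewrite -exprMn lerXn2r // nnegrE ?mulr_ge0 // ltW.
have q1 : mu ^+ 2 <= 4 * (M ^+ 2 * r ^+ 2).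
  have -> : 4 * (M ^+ 2 * r ^+ 2) = (2 * M * r) ^+ 2 by ring.
  by rewrite lerXn2r // nnegrE ?mulr_ge0 // ltW.
(* Completing a square trades the odd power of [tau] for even ones. *)
have h1 : 96 * mu * M * tau ^+ 3 <= 288 * M ^+ 2 * tau ^+ 4 + 8 * mu ^+ 2 * tau ^+ 2.
  rewrite -subr_ge0.
  have -> : 288 * M ^+ 2 * tau ^+ 4 + 8 * mu ^+ 2 * tau ^+ 2 - 96 * mu * M * tau ^+ 3
    = 8 * tau ^+ 2 * (6 * M * tau - mu) ^+ 2 by ring.
  by rewrite mulr_ge0 ?sqr_ge0 // mulr_ge0 ?sqr_ge0.
(* The factor [4 * 288 M^2] completes a square in [tau^2]. The rest is concave in [mu^2] and
   nonnegative for [mu^2] between [M^2 r^2] and [4 M^2 r^2]. *)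
have h2 : 0 <= 288 * M ^+ 2 * tau ^+ 4 - 8 * mu ^+ 2 * tau ^+ 2
    + mu ^+ 2 * r ^+ 2 - M ^+ 2 * r ^+ 4 / 4.
  have c0 : 0 < 1152 * M ^+ 2.
    apply: mulr_gt0; first by lra.
    exact: exprn_gt0.
  rewrite -(pmulr_rge0 _ c0).
  have -> : 1152 * M ^+ 2 * (288 * M ^+ 2 * tau ^+ 4 - 8 * mu ^+ 2 * tau ^+ 2
      + mu ^+ 2 * r ^+ 2 - M ^+ 2 * r ^+ 4 / 4) =
    (576 * M ^+ 2 * tau ^+ 2 - 8 * mu ^+ 2) ^+ 2
      + (1152 * (M ^+ 2 * r ^+ 2) * mu ^+ 2 - 288 * (M ^+ 2 * r ^+ 2) ^+ 2
         - 64 * (mu ^+ 2) ^+ 2) by field.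
  apply: addr_ge0; first exact: sqr_ge0.
  by have := sqr_ge0 mu; nra.
suff : 2 * mu * (2 * (24 * M * tau ^+ 2) * tau) <= 2 * mu * (- D).
  by rewrite ler_pM2l ?mulr_gt0.
have e1 : 2 * mu * (2 * (24 * M * tau ^+ 2) * tau) = 96 * mu * M * tau ^+ 3 by ring.
have e2 : (M / 2 * r ^+ 2) ^+ 2 = M ^+ 2 * r ^+ 4 / 4 by field.
have e3 : (24 * M * tau ^+ 2) ^+ 2 = 576 * M ^+ 2 * tau ^+ 4 by ring.
by rewrite e1; rewrite e2 e3 in h; lra.
Qed.

(** * The estimate function and its update *)

Section Estimate.
Variables (f : 'cV[R]_n -> R) (M : R) (x0 : 'cV[R]_n).
Hypotheses (M_gt0 : 0 < M)
  (convex_grad : forall x y, f x + dot (grad f x) (y - x) <= f y).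

(** Tetrahedral numbers: their increments are the coefficients [(k + 1) (k + 2) / 2] of the
    gradients in [s]. *)
Definition weight (k : nat) : R := (k * (k + 1) * (k + 2))%:R / 6.

(* The estimate function is [z |-> b + <s, z> + 8 M |z - x0|^3], with
   minimizer [v]. *)
Definition estimate (k : nat) x v s : Prop :=
  exists b : R, [/\ forall z, b + dot s z <= weight k * f z,
    weight k * f x <= b + dot s v + 8 * M * enorm (v - x0) ^+ 3
  & s + (24 * M * enorm (v - x0)) *: (v - x0) = 0].

Lemma estimate_init : estimate 0 x0 x0 0.
Proof.
exists 0; rewrite /weight !mul0n !mul0r; split.
- by move=> z; rewrite dot0l addr0 mul0r.
- by rewrite dot0l subrr enorm0 expr0n /= !mulr0 !addr0.
- by rewrite subrr scaler0 addr0.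
Qed.

(** Uniform convexity of the cubic around [v], scaled by [24 M]; stationarity at [v] cancels the
    linear terms. *)
Lemma estimate_lower k x v s z b :
  weight k * f x <= b + dot s v + 8 * M * enorm (v - x0) ^+ 3 ->
  s + (24 * M * enorm (v - x0)) *: (v - x0) = 0 ->
  weight k * f x + 4 * M * enorm (z - v) ^+ 3 <=
    b + dot s z + 8 * M * enorm (z - x0) ^+ 3.
Proof.
move=> h /eqP; rewrite addr_eq0 => /eqP sE.
have := cubic_uniformly_convex (v - x0) (z - x0).
rewrite (_ : z - x0 - (v - x0) = z - v); last by rewrite opprB addrA subrK.
rewrite -(ler_pM2l (_ : 0 < 24 * M)) ?mulr_gt0 // => c.
have -> : dot s z = dot s v - 24 * M * enorm (v - x0) * dot (v - x0) (z - v).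
  by rewrite sE !dotE; ring.
move: h c; set a := enorm (v - x0); set e := enorm (z - x0); set t := enorm (z - v).
set D := dot (v - x0) _ => h.
have -> : 24 * M * (a ^+ 3 / 3 + a * D + t ^+ 3 / 6) =
  8 * M * a ^+ 3 + 24 * M * a * D + 4 * M * t ^+ 3 by field.
have -> : 24 * M * (e ^+ 3 / 3) = 8 * M * e ^+ 3 by field.
lra.
Qed.

(** At a minimizer [z] this serves twice: it bounds the gap at [x] and the distance from [v]. *)
Lemma estimate_gap k x v s z : estimate k x v s ->
  weight k * (f x - f z) + 4 * M * enorm (z - v) ^+ 3 <= 8 * M * enorm (z - x0) ^+ 3.
Proof.
case=> b [hb hx hs]; have := estimate_lower _ _ _ _ z _ hx hs; have := hb z.
by rewrite mulrBr; lra.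
Qed.

(** The tangent at [x'], weighted by [a], joins the estimate function, and also bounds [f x] from
    below. Since [y] is a weighted mean, the linear terms reduce to [<g, y - x'>], large by
    hypothesis, and [<g, v' - v>], absorbed by the cubic growth around [v]. *)
Lemma estimate_step k x v s x' :
  let y := (k%:R / (k + 3)%:R) *: x + (3 / (k + 3)%:R) *: v in
  let a := ((k + 1) * (k + 2))%:R / 2 in
  let s' := s + a *: grad f x' in
  let v' := x0 - Num.sqrt (1 / (24 * M * enorm s')) *: s' in
  (forall tau : R, 0 <= tau -> enorm (grad f x') = 24 * M * tau ^+ 2 ->
     2 * enorm (grad f x') * tau <= dot (grad f x') (y - x')) ->
  estimate k x v s -> estimate k.+1 x' v' s'.
Proof.
move=> y a s' v' hstep [b [hb hx hs]].
set g := grad f x' in s' v' hstep *.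
pose N : R := k%:R + 3.
have k0 : 0 <= k%:R :> R by [].
have aE : a = (N - 2) * (N - 1) / 2.
  by rewrite /a /N natrM !natrD; congr (_ / _); ring.
have wE : weight k = (N - 3) * (N - 2) * (N - 1) / 6.
  by rewrite /weight /N !natrM !natrD; congr (_ / _); ring.
have w'E : weight k.+1 = N * a / 3.
  by rewrite aE /weight /N !natrM !natrD -natr1; field.
have ww : weight k.+1 = weight k + a by rewrite w'E wE aE; field.
have N3 : 3 <= N by rewrite /N lerDr.
have a0 : 0 <= a by rewrite divr_ge0.
have w0 : 0 <= weight k by rewrite divr_ge0.
have aN : 2 * a <= N ^+ 2 by rewrite aE; lra.
(* Here [a / weight k.+1 = 3 / N]. *)
have yE : weight k.+1 *: y = weight k *: x + a *: v.
  rewrite /y scalerDr !scalerA w'E natrD -/N; congr (_ *: _ + _ *: _).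
    by rewrite wE aE /N; field; rewrite -/N gt_eqF //; lra.
  by field; rewrite gt_eqF //; lra.
exists (b + a * (f x' - dot g x')); split.
- move=> z; have := hb z; have := convex_grad x' z; rewrite -/g ww /s'.
  by rewrite dotDr dotNr dotDl dotZl; nra.
- have := estimate_lower _ _ _ _ v' _ hx hs.
  have := convex_grad x' x; rewrite -/g => cx low.
  pose u := enorm g; pose t := enorm (v' - v).
  pose tau := Num.sqrt (u / (24 * M)).
  have u0 : 0 <= u := enorm_ge0 _.
  have uE : u = 24 * M * tau ^+ 2.
    by rewrite sqr_sqrtr ?divr_ge0 ?mulr_ge0 ?(ltW M_gt0) //; field; rewrite gt_eqF.
  have tau0 : 0 <= tau := sqrtr_ge0 _.
  have t0 : 0 <= t := enorm_ge0 _.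
  have hD := hstep tau tau0 uE; rewrite -/u in hD.
  have yD : weight k * dot g (x - x') + a * dot g (v' - x') =
      weight k.+1 * dot g (y - x') + a * dot g (v' - v).
    have e : weight k.+1 * dot g y = weight k * dot g x + a * dot g v.
      by rewrite -!dotZr -dotDr -yE.
    rewrite (dotDr g y) (dotDr g x) (dotDr g v' (- x')) (dotDr g v' (- v)) !dotNr.
    by rewrite [weight k.+1 * _]mulrDr e ww; ring.
  have gt : - (u * t) <= dot g (v' - v).
    by have := dot_abs_le g (v' - v); rewrite ler_norml => /andP[].
  (* Young's inequality as [t^3 - 3 p^2 t + 2 p^3 = (t - p)^2 (t + 2 p)] with [p = N tau]; the
     surplus of [t^3] is nonnegative as [2 a <= N^2]. *)
  have key : 0 <= N * a / 3 * (2 * u * tau) - a * (u * t) + 4 * M * t ^+ 3.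
    have N20 : 0 < N ^+ 2 by rewrite exprn_gt0 //; lra.
    rewrite uE -(pmulr_rge0 _ N20).
    have -> : N ^+ 2 * (N * a / 3 * (2 * (24 * M * tau ^+ 2) * tau)
        - a * (24 * M * tau ^+ 2 * t) + 4 * M * t ^+ 3) =
      4 * M * ((N ^+ 2 - 2 * a) * t ^+ 3
        + 2 * a * ((t - N * tau) ^+ 2 * (t + 2 * N * tau))) by field.
    have N0 : 0 <= N by lra.
    have h1 : 0 <= (N ^+ 2 - 2 * a) * t ^+ 3 by rewrite mulr_ge0 ?exprn_ge0 ?subr_ge0.
    have h2 : 0 <= (t - N * tau) ^+ 2 * (t + 2 * N * tau).
      by rewrite mulr_ge0 ?sqr_ge0 ?addr_ge0 ?mulr_ge0.
    apply: mulr_ge0; first by rewrite mulr_ge0 // ltW.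
    by apply: addr_ge0 => //; apply: mulr_ge0 => //; exact: mulr_ge0.
  have k1 : N * a / 3 * (2 * u * tau) <= weight k.+1 * dot g (y - x').
    by rewrite w'E ler_wpM2l // divr_ge0 ?mulr_ge0 //; lra.
  have k2 : - (a * (u * t)) <= a * dot g (v' - v).
    by rewrite -mulrN ler_wpM2l.
  have k3 : weight k * (f x' + dot g (x - x')) <= weight k * f x by rewrite ler_wpM2l.
  have e1 : dot s' v' = dot s v' + a * dot g v' by rewrite /s' dotDl dotZl.
  have e2 : dot g (v' - x') = dot g v' - dot g x' by rewrite dotDr dotNr.
  rewrite e2 in yD; rewrite e1 ww; rewrite -/t in low.
  rewrite mulrDr in k3; lra.
- have -> : v' - x0 = - (Num.sqrt (1 / (24 * M * enorm s')) *: s').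
    by rewrite /v' addrAC subrr add0r.
  rewrite enormN enormZ ger0_norm ?sqrtr_ge0 // scalerN scalerA.
  apply/eqP; rewrite subr_eq0; apply/eqP.
  (* For [s' = 0] the scalar multiplies the zero vector; otherwise [24 M |s'| c^2 = 1] is the
     stationarity condition. *)
  have [/eqP|S0] := boolP (enorm s' == 0).
    by move=> /eqP; rewrite enorm_eq0 => /eqP ->; rewrite scaler0.
  have {}S0 : 0 < enorm s' by rewrite lt_neqAle eq_sym S0 enorm_ge0.
  set c := Num.sqrt _.
  have cE : c ^+ 2 = 1 / (24 * M * enorm s').
    by rewrite sqr_sqrtr // divr_ge0 ?mulr_ge0 ?ltW.
  rewrite (_ : _ * c = 24 * M * enorm s' * c ^+ 2); last by ring.
  by rewrite cE mulrC divfK ?scale1r // mulf_neq0 ?gt_eqF // mulr_gt0.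
Qed.

End Estimate.
End Acceleration.

(** * Oracle calls and local detection *)

Section Oracle.
Context {R : realType} {n : nat}.
Variables (f : 'cV[R]_n -> R) (TR : 'cV[R]_n -> R -> R -> 'cV[R]_n * R).
Variables (M kappa : R).
Implicit Types (x y z v w d : 'cV[R]_n).
Hypotheses (M_gt0 : 0 < M) (kappa_gt0 : 0 < kappa)
  (grad_diff : forall x, differentiable (grad f) x)
  (hess_lip : forall x y, specnorm (hess f x - hess f y) <= M * enorm (x - y))
  (hess_bound : forall x, specnorm (hess f x) <= kappa)
  (hess_psd : forall x v, 0 <= dot v (hess f x *m v))
  (TRo : TR_oracle f TR).

Lemma enorm_gt0 v : (0 < enorm v) = (v != 0).
Proof. by rewrite lt_neqAle eq_sym enorm_eq0 enorm_ge0 andbT. Qed.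

(** [mu] is the sum of regularization and multiplier, so that oracle answers and the step behind the
    initial [r_+] are treated alike. *)
Definition damped_newton y (mu : R) d : Prop :=
  hess f y *m d + mu *: d = - grad f y.

Lemma TR_oracleP y (sigma r : R) :
  0 <= sigma -> 0 < r -> grad f y != 0 ->
  let: (d, lambda) := TR y sigma r in
  [/\ enorm d <= r, 0 <= lambda, lambda * (enorm d - r) = 0
    & damped_newton y (sigma + lambda) d].
Proof.
move=> s0 r0 g0; have := TRo y sigma r s0 (ltW r0); rewrite (negbTE g0) => /(_ r0).
case: (TR y sigma r) => d lambda /= [h1 h2 h3 h4 _]; split => //.
by rewrite /damped_newton -h4 !mulmxDl !mul_scalar_mx scalerDl addrA.
Qed.

(** Symmetry is part of what the oracle certifies where the gradient is nonzero; it is read off an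
    answer with [sigma = 0], [r = 1]. *)
Lemma hess_sym y : grad f y != 0 -> (hess f y)^T = hess f y.
Proof.
move=> g0; have := TRo y 0 1 (lexx _) ler01; rewrite (negbTE g0) => /(_ ltr01) [_ _ _ _].
case=> + _; rewrite !linearD /= !tr_scalar_mx => /addIr; exact: addIr.
Qed.

Lemma damped_newton_neq0 y (mu : R) d :
  grad f y != 0 -> damped_newton y mu d -> d != 0.
Proof.
move=> g0 hd; apply: contra g0 => /eqP d0.
by rewrite -oppr_eq0 -hd d0 mulmx0 scaler0 addr0.
Qed.

Lemma damped_newton_grad y (mu : R) d :
  grad f y != 0 -> damped_newton y mu d ->
  enorm (grad f (y + d) + mu *: d) <= M / 2 * enorm d ^+ 2.
Proof.
move=> g0 hd.
have := @grad_taylor _ _ f grad_diff M y d (ltW M_gt0) hess_lip.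
rewrite (hess_sym y g0); have -> : hess f y *m d = - grad f y - mu *: d.
  by rewrite -hd addrK.
by rewrite opprD !opprK addrA subrK.
Qed.

(** Pair the equation with [d] and drop [<d, H d> >= 0]. *)
Lemma damped_newton_le y (mu : R) d :
  damped_newton y mu d -> mu * enorm d <= enorm (grad f y).
Proof.
move=> hd; have [->|d0] := eqVneq d 0; first by rewrite enorm0 mulr0 enorm_ge0.
rewrite -enorm_gt0 in d0; rewrite -(ler_pM2r d0).
have := congr1 (dot d) hd; rewrite !dotE -sqr_enorm => e.
have := dot_abs_le d (grad f y); rewrite ler_norml => /andP[h _].
by have := hess_psd y d; lra.
Qed.

Definition accepted y x : Prop :=
  exists d mu, [/\ x = y + d, damped_newton y mu d,
    M * enorm d <= mu & mu <= 2 * M * enorm d].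

Lemma accepted_decrease y x (tau : R) : grad f y != 0 -> accepted y x ->
  0 <= tau -> enorm (grad f x) = 24 * M * tau ^+ 2 ->
  2 * enorm (grad f x) * tau <= dot (grad f x) (y - x).
Proof.
move=> g0 [d [mu [-> hd h1 h2]]] tau0 gE.
rewrite opprD addrA subrr add0r dotNr.
apply: (@regularized_step_decrease _ _ M mu) => //.
  exact: damped_newton_neq0 hd.
exact: damped_newton_grad.
Qed.

(** Subtracting the equations and pairing with [d2 - d1] gives [<d2 - d1, d1> >= 0]. *)
Lemma damped_newton_antitone y mu1 d1 mu2 d2 :
  damped_newton y mu1 d1 -> damped_newton y mu2 d2 -> 0 <= mu2 < mu1 ->
  enorm d1 <= enorm d2.
Proof.
move=> h1 h2 /andP[mu20 mu12].
have e : hess f y *m (d2 - d1) + mu2 *: (d2 - d1) = (mu1 - mu2) *: d1.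
  by rewrite mulmxBr scalerBr addrACA h2 -h1 scalerBl addrACA subrr add0r.
have := congr1 (dot (d2 - d1)) e; rewrite dotDr !dotZr => {}e.
have : 0 <= (mu1 - mu2) * dot (d2 - d1) d1.
  by rewrite -e addr_ge0 // mulr_ge0 // dot_ge0.
rewrite pmulr_rge0 ?subr_gt0 // dotDl dotNl -sqr_enorm => h.
have [->|d0] := eqVneq d1 0; first by rewrite enorm0 enorm_ge0.
rewrite -enorm_gt0 in d0; rewrite -(ler_pM2r d0).
by have := dot_le d2 d1; lra.
Qed.

(** * Width of the brackets and termination of the bisection *)

Section Bisection.
Variables (y : 'cV[R]_n) (G rho : R).
Hypotheses (g0 : grad f y != 0) (gG : enorm (grad f y) <= G) (rho_gt0 : 0 < rho).

(** With [t = mu1 - mu2 > 0], cocoercivity gives [t r1 <= (kappa + mu2) (r2 - r1)], and the ratios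
    give [t > M (2 r1 - r2)]. Hence [M r1^2 <= (r2 - r1) (kappa + 2 mu1)], where [mu1 r1 <= G]
    removes [mu1]. *)
Lemma bracket_width mu1 d1 mu2 d2 :
  damped_newton y mu1 d1 -> damped_newton y mu2 d2 ->
  2 * M * enorm d1 < mu1 -> 0 <= mu2 -> mu2 <= M * enorm d2 -> rho <= enorm d1 ->
  M * rho ^+ 3 <= (enorm d2 - enorm d1) * (kappa * rho + 2 * G).
Proof.
move=> h1 h2 hmu1 mu20 hmu2 hrho.
have mu1G : mu1 * enorm d1 <= G := le_trans (damped_newton_le _ _ _ h1) gG.
have r0 : 0 < enorm d1 := lt_le_trans rho_gt0 hrho.
have G0 : 0 < G by apply: lt_le_trans gG; rewrite enorm_gt0.
pose t := mu1 - mu2; pose P := hess f y + mu2%:M.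
have PE v : P *m v = hess f y *m v + mu2 *: v by rewrite mulmxDl mul_scalar_mx.
have Pw : P *m (d2 - d1) = t *: d1.
  rewrite mulmxBr !PE h2 -h1 scalerBl opprD.
  by rewrite addrACA subrr add0r.
have L0 : 0 <= kappa + mu2 by rewrite addr_ge0 // ltW.
have coer : enorm (P *m (d2 - d1)) ^+ 2 <= (kappa + mu2) * dot (d2 - d1) (P *m (d2 - d1)).
  apply: psd_coercive.
  - by rewrite linearD /= tr_scalar_mx hess_sym.
  - by move=> v; rewrite PE !dotE addr_ge0 // mulr_ge0 // dot_ge0.
  - move=> v; rewrite PE !dotE -sqr_enorm mulrDl lerD2r.
    by have := @dot_mulmx_le _ _ _ v v _ (hess_bound y); rewrite -mulrA -expr2.
move: coer; rewrite Pw enormZ dotZr dotDl dotNl -sqr_enorm exprMn real_normK ?num_real //.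
have := dot_le d2 d1; move: hmu1 hmu2 hrho mu1G r0; set r1 := enorm d1; set r2 := enorm d2.
set D := dot _ _ => hmu1 hmu2 hrho mu1G r0 hD coer.
have key : M * r1 ^+ 2 <= (r2 - r1) * (kappa + 2 * mu1) /\ 0 <= r2 - r1.
  (* For [t <= 0] already [2 M r1 < mu1 <= mu2 <= M r2]. *)
  have [t0|t0] := leP t 0.
    have rr : r1 < r2 - r1.
      by rewrite -(ltr_pM2l M_gt0); rewrite /t in t0; lra.
    split; last by lra.
    have : M * r1 * r1 <= r1 * mu1 by rewrite mulrC ler_pM2l //; nra.
    have mu10 : 0 <= mu1 by nra.
    have : r1 * mu1 <= (r2 - r1) * mu1 by rewrite ler_wpM2r // ltW.
    have D0 : 0 <= r2 - r1 by lra.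
    have := mulr_ge0 D0 mu10; have := mulr_ge0 D0 (ltW kappa_gt0).
    by rewrite mulrDr expr2; lra.
  have c1 : t * r1 <= (kappa + mu2) * (r2 - r1).
    rewrite -(ler_pM2l t0) -(ler_pM2r r0).
    have : (kappa + mu2) * (t * (D - r1 ^+ 2)) <= (kappa + mu2) * (t * (r2 * r1 - r1 ^+ 2)).
      by rewrite ler_wpM2l // ler_wpM2l ?(ltW t0) //; lra.
    by nra.
  have c0 : 0 < r2 - r1.
    by have : 0 < (kappa + mu2) * (r2 - r1) by [apply: lt_le_trans c1; rewrite mulr_gt0];
       rewrite pmulr_rgt0 // ltr_wpDr.
  split; last exact: ltW.
  have c2 : M * (r1 - (r2 - r1)) * r1 <= t * r1.
    by rewrite ler_pM2r // /t; nra.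
  have c3 : (kappa + mu2 + M * r1) * (r2 - r1) <= (kappa + 2 * mu1) * (r2 - r1).
    by rewrite ler_pM2r // /t in t0 *; nra.
  by nra.
case: key => key rr.
have key3 : M * r1 ^+ 3 <= (r2 - r1) * (kappa * r1 + 2 * G).
  have : M * r1 ^+ 2 * r1 <= (r2 - r1) * (kappa + 2 * mu1) * r1 by rewrite ler_pM2r.
  have : (r2 - r1) * (mu1 * r1) <= (r2 - r1) * G by rewrite ler_wpM2l.
  by nra.
have p1 : 0 < kappa * r1 + 2 * G by rewrite addr_gt0 ?mulr_gt0.
have p2 : 0 < kappa * rho + 2 * G by rewrite addr_gt0 ?mulr_gt0.
rewrite -(ler_pM2r p1).
have : M * r1 ^+ 3 * (kappa * rho + 2 * G) <=
    (r2 - r1) * (kappa * r1 + 2 * G) * (kappa * rho + 2 * G) by rewrite ler_pM2r.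
(* [r^3 / (kappa r + 2 G)] increases with [r], so [r1] may be lowered to [rho]. *)
suff : M * rho ^+ 3 * (kappa * r1 + 2 * G) <= M * r1 ^+ 3 * (kappa * rho + 2 * G) by lra.
have q2 : rho ^+ 2 <= r1 ^+ 2 by rewrite lerXn2r // nnegrE ltW.
have q3 : rho ^+ 3 <= r1 ^+ 3 by rewrite lerXn2r // nnegrE ltW.
have q4 : rho ^+ 3 * G <= r1 ^+ 3 * G by rewrite ler_wpM2r // ltW.
have q5 : rho * r1 * kappa * rho ^+ 2 <= rho * r1 * kappa * r1 ^+ 2.
  by apply: ler_wpM2l => //; rewrite !mulr_ge0 // ltW.
rewrite -!(mulrA M); apply: ler_wpM2l; first exact: ltW.
by lra.
Qed.

(** Each call halves the bracket, whose width stays at least [delta] by [bracket_width]. The lower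
    end is attained by [d1], whereas the upper end only bounds [|d2|], since [mu = 0] may leave the
    constraint inactive. *)
Lemma bisection_terminates (delta : R) (m : nat) (rm rp : R) mu1 d1 mu2 d2 :
  delta * (kappa * rho + 2 * G) <= M * rho ^+ 3 ->
  damped_newton y mu1 d1 -> damped_newton y mu2 d2 ->
  enorm d1 = rm -> rho <= rm -> 2 * M * rm < mu1 ->
  0 <= mu2 -> mu2 <= M * enorm d2 -> enorm d2 <= rp -> rp - rm < 2 ^+ m * delta ->
  exists x c, [/\ bisection TR M y rm rp x c, (c <= m)%N & accepted y x].
Proof.
move=> hdelta; elim: m rm rp mu1 d1 mu2 d2 => [|m IH] rm rp mu1 d1 mu2 d2
  h1 h2 E1 hrho hmu1 mu20 hmu2 hrp width.
  (* With no call left, a bracket narrower than [delta] is contradictory. *)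
  have G0 : 0 < G by apply: lt_le_trans gG; rewrite enorm_gt0.
  have p2 : 0 < kappa * rho + 2 * G by rewrite addr_gt0 ?mulr_gt0.
  rewrite -E1 in hmu1 hrho width.
  have := bracket_width _ _ _ _ h1 h2 hmu1 mu20 hmu2 hrho => W.
  have := le_trans hdelta W; rewrite ler_pM2r // => W'.
  by exfalso; move: width; rewrite expr0 mul1r; lra.
have rm0 : 0 < rm := lt_le_trans rho_gt0 hrho.
have rp0 : 0 <= rp := le_trans (enorm_ge0 _) hrp.
pose r := (rm + rp) / 2.
have r0 : 0 < r by rewrite /r; lra.
have := TR_oracleP y 0 r (lexx _) r0 g0.
case E: (TR y 0 r) => [d mu]; rewrite add0r => -[dr mu0 comp hd].
have d0 := damped_newton_neq0 _ _ _ g0 hd; rewrite -enorm_gt0 in d0.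
have [hM|hM] := ltP (mu / enorm d) M.
  have hM' : mu <= M * enorm d by rewrite -ler_pdivrMr // ltW.
  have hw : r - rm < 2 ^+ m * delta by rewrite /r; move: width; rewrite exprS; lra.
  have [x [c [hb hc ha]]] := IH rm r mu1 d1 mu d h1 hd E1 hrho hmu1 mu0 hM' dr hw.
  by exists x, c.+1; split=> //; apply: bisection_upper hM hb.
have [h2M|h2M] := ltP (2 * M) (mu / enorm d).
  have h2M' : 2 * M * enorm d < mu by rewrite -ltr_pdivlMr.
  have {}mu0 : 0 < mu by apply: le_lt_trans h2M'; rewrite !mulr_ge0 // ltW.
  (* A positive multiplier makes the constraint active. *)
  have dE : enorm d = r.
    by move/eqP: comp; rewrite mulf_eq0 gt_eqF //= subr_eq0 => /eqP.
  have rrm : rm <= r.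
    have G0 : 0 < G by apply: lt_le_trans gG; rewrite enorm_gt0.
    have p2 : 0 < kappa * rho + 2 * G by rewrite addr_gt0 ?mulr_gt0.
    rewrite -E1 in hmu1 hrho.
    have := bracket_width _ _ _ _ h1 h2 hmu1 mu20 hmu2 hrho => W.
    have : 0 < (enorm d2 - enorm d1) * (kappa * rho + 2 * G).
      by apply: lt_le_trans W; rewrite mulr_gt0 ?exprn_gt0.
    by rewrite pmulr_lgt0 // E1 /r; lra.
  rewrite dE in h2M'.
  have hw : rp - r < 2 ^+ m * delta by rewrite /r; move: width; rewrite exprS; lra.
  have [x [c [hb hc ha]]] := IH r rp mu d mu2 d2 hd h2 dE (le_trans hrho rrm) h2M' mu20 hmu2 hrp hw.
  by exists x, c.+1; split=> //; apply: bisection_lower h2M hb.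
exists (y + d), 1%N; split=> //; first by apply: bisection_stop (esym E) _; rewrite hM.
by exists d, mu; split=> //; [rewrite -ler_pdivlMr | rewrite -ler_pdivrMr].
Qed.

End Bisection.

Lemma local_diving_spec (eps : R) (m : nat) z :
  ((local_diving f eps m z).2 <= m)%N /\
  (forall z', (local_diving f eps m z).1 = Some z' -> enorm (grad f z') <= eps).
Proof.
elim: m z => [|m IH] z //=.
case: ifP => // _; case: ifPn => [h|_]; first by split=> // _ [<-].
move: (IH (z - invmx (hess f z) *m grad f z)).
by case: (local_diving f eps m _) => o c [].
Qed.

(** A kernel vector would satisfy [<v, H v> + c |v|^2 = 0]. [det0P] yields a row vector, hence the
    transpositions. *)
Lemma damped_newton_invmx y (c : R) : grad f y != 0 -> 0 < c ->
  damped_newton y c (- (invmx (hess f y + c%:M) *m grad f y)).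
Proof.
move=> g0 c0.
have u : hess f y + c%:M \in unitmx.
  rewrite unitmxE unitfE; apply/det0P => -[v v0 hv].
  have hv' : (hess f y + c%:M) *m v^T = 0.
    apply: trmx_inj; rewrite trmx_mul trmxK linearD /= tr_scalar_mx hess_sym //.
    by rewrite hv trmx0.
  have := congr1 (dot v^T) hv'; rewrite mulmxDl mul_scalar_mx !dotE => e.
  have := hess_psd y v^T; have : 0 < c * dot v^T v^T.
    rewrite mulr_gt0 // -sqr_enorm exprn_gt0 // enorm_gt0.
    by rewrite -(inj_eq trmx_inj) trmxK trmx0.
  by lra.
by rewrite /damped_newton -mul_scalar_mx -mulmxDl mulmxN mulKVmx.
Qed.

(** * Cost and outcome of one iteration *)

Section Iteration.
Variables (eps G rho delta : R) (m0 m : nat).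
Hypotheses (eps_gt0 : 0 < eps) (eps_small : M * eps <= 2 * kappa ^+ 2)
  (rho_gt0 : 0 < rho)
  (rho_le : rho <= Num.min (eps / (2 * kappa)) (Num.sqrt (eps / M)))
  (delta_le : delta * (kappa * rho + 2 * G) <= M * rho ^+ 3)
  (m_large : G / (M * rho) < 2 ^+ m * delta).

(* The test of Track 0 forces sigma <= kappa, as sigma^2 = M |grad f y| / 2. *)
Lemma short_step_grad y d (sigma : R) :
  grad f y != 0 -> damped_newton y sigma d -> 0 <= sigma ->
  sigma ^+ 2 = M / 2 * enorm (grad f y) ->
  enorm d <= Num.min (eps / (2 * kappa)) (Num.sqrt (eps / M)) ->
  enorm (grad f (y + d)) <= eps.
Proof.
move=> g0 hd s0 sE; rewrite le_min => /andP[d1 d2].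
have r0 := enorm_ge0 d.
have d1' : 2 * kappa * enorm d <= eps.
  by rewrite mulrC -ler_pdivlMr // mulr_gt0.
have d2' : M * enorm d ^+ 2 <= eps.
  rewrite mulrC -ler_pdivlMr // -(sqr_sqrtr (_ : 0 <= eps / M)); last first.
    by rewrite divr_ge0 // ltW.
  by rewrite lerXn2r // nnegrE ?sqrtr_ge0.
have gle : enorm (grad f y) <= (kappa + sigma) * enorm d.
  rewrite -enormN -hd; apply: le_trans (enormD _ _) _.
  rewrite enormZ ger0_norm // mulrDl lerD2r.
  apply: le_trans (enorm_mulmx _ _) _.
  by rewrite ler_wpM2r.
(* If [sigma > kappa], then [sigma <= M |d| <= M eps / (2 kappa) <= kappa]. *)
have sk : sigma <= kappa.
  rewrite leNgt; apply/negP => ks.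
  have : sigma ^+ 2 <= M / 2 * ((kappa + sigma) * enorm d).
    by rewrite sE ler_wpM2l // divr_ge0 // ltW.
  have : (kappa + sigma) * enorm d <= 2 * sigma * enorm d.
    by rewrite ler_wpM2r //; lra.
  move=> h1 h2; have {h1 h2} : sigma * sigma <= sigma * (M * enorm d).
    have : M / 2 * ((kappa + sigma) * enorm d) <= M / 2 * (2 * sigma * enorm d).
      by rewrite ler_wpM2l // divr_ge0 // ltW.
    by rewrite -expr2; lra.
  rewrite ler_pM2l; last by rewrite (lt_trans kappa_gt0).
  have : M * (2 * kappa * enorm d) <= M * eps by rewrite ler_wpM2l // ltW.
  move=> h1 h2; have : kappa * kappa < kappa * (M * enorm d).
    by rewrite ltr_pM2l // (lt_le_trans ks).
  by move: h1 eps_small; rewrite expr2; lra.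
have := damped_newton_grad _ _ _ g0 hd => h.
have -> : grad f (y + d) = (grad f (y + d) + sigma *: d) - sigma *: d by rewrite addrK.
apply: le_trans (enormD _ _) _; rewrite enormN enormZ (ger0_norm s0).
(* Remainder and damping term are each at most [eps / 2]. *)
have : sigma * enorm d <= kappa * enorm d by rewrite ler_wpM2r.
by lra.
Qed.

(** Failure of Track 0 gives [rho <= |d|], as the bisection bound requires. The calls are at most
    [m0] Newton steps, one for the initial [r_+] and [m] halvings. *)
Lemma local_detection_spec y d (sigma : R) :
  grad f y != 0 -> enorm (grad f y) <= G -> damped_newton y sigma d ->
  M * enorm d <= sigma -> sigma ^+ 2 = M / 2 * enorm (grad f y) ->
  (diving_steps f eps y <= m0)%N ->
  exists x et c, [/\ local_detection f TR M kappa eps y sigma d x et c,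
    (c <= m0 + m + 1)%N & if et return Prop then enorm (grad f x) <= eps else accepted y x].
Proof.
move=> g0 gG hd hM sE hm0.
have s0 : 0 <= sigma by apply: le_trans hM; rewrite mulr_ge0 ?enorm_ge0 ?ltW.
have [dle|dgt] := leP (enorm d) (Num.min (eps / (2 * kappa)) (Num.sqrt (eps / M))).
  exists (y + d), true, 0%N; split=> //; last exact: short_step_grad sE dle.
  by rewrite /local_detection dle.
have rhod : rho <= enorm d := le_trans rho_le (ltW dgt).
have d0 : 0 < enorm d := lt_le_trans rho_gt0 rhod.
have := local_diving_spec eps (diving_steps f eps y) y.
case E: (local_diving _ _ _ _) => [[z|] c1] /= [/leq_trans/(_ hm0) c1m hz].
  exists z, true, c1; split; [|by rewrite -addnA (leq_trans c1m) ?leq_addr|exact: hz].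
  by rewrite /local_detection leNgt dgt /= E.
have [h2M|] := leP (sigma / enorm d) (2 * M).
  exists (y + d), false, c1; split; [|by rewrite -addnA (leq_trans c1m) ?leq_addr|].
    by rewrite /local_detection leNgt dgt /= E h2M.
  by exists d, sigma; split=> //; rewrite -ler_pdivrMr.
move=> h2M'; have := h2M'; rewrite ltr_pdivlMr // => h2M.
pose rp := enorm (invmx (hess f y + (M * enorm d)%:M) *m grad f y).
(* [rp] is the length of the damped step with [mu = M |d|]. Less damped than [d], it is no shorter,
   so [mu <= M |d2|] at the upper end. *)
pose d2 := - (invmx (hess f y + (M * enorm d)%:M) *m grad f y).
have mu2 : 0 < M * enorm d by rewrite mulr_gt0.
have hd2 : damped_newton y (M * enorm d) d2 by exact: damped_newton_invmx.
have rpE : enorm d2 = rp by rewrite enormN.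
have dd2 : enorm d <= enorm d2.
  by apply: damped_newton_antitone hd hd2 _; rewrite (ltW mu2) /=; lra.
have rp_le : rp <= G / (M * rho).
  rewrite ler_pdivlMr ?mulr_gt0 //; apply: le_trans gG.
  apply: le_trans (damped_newton_le _ _ _ hd2); rewrite rpE mulrC.
  by rewrite ler_wpM2r ?enorm_ge0 // ler_pM2l.
have width : rp - enorm d < 2 ^+ m * delta.
  by apply: le_lt_trans m_large; lra.
have hmu2 : M * enorm d <= M * enorm d2 by rewrite ler_pM2l.
have rp_ge : enorm d2 <= rp by rewrite rpE.
have [x [c [hb hc ha]]] := bisection_terminates y G rho g0 gG rho_gt0 delta m
  (enorm d) rp sigma d (M * enorm d) d2 delta_le hd hd2 erefl rhod h2M (ltW mu2)
  hmu2 rp_ge width.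
exists x, false, (c1 + 1 + c)%N; split=> //; last by rewrite addnAC leq_add2r leq_add.
by rewrite /local_detection leNgt dgt /= E leNgt h2M' /=; exists c.
Qed.

(** All rests on [sigma = M r] and [|grad f y| = 2 M r^2]. If [lambda = 0], then [M |d| <= sigma],
    as local detection requires. Otherwise [|d| = r], so [mu >= M |d|], and [mu r <= |grad f y|]
    gives [mu <= 2 M |d|]. *)
Lemma iteration_spec (k : nat) x v :
  let y := (k%:R / (k + 3)%:R) *: x + (3 / (k + 3)%:R) *: v in
  enorm (grad f y) <= G -> (diving_steps f eps y <= m0)%N ->
  exists x' et c, [/\ iteration f TR M kappa eps k x v x' et c,
    (c <= m0 + m + 2)%N
    & if et return Prop then enorm (grad f x') <= eps
      else grad f y != 0 /\ accepted y x'].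
Proof.
move=> y gG hm0; rewrite /iteration -/y.
set sigma := _ / 2 * _; set r := 1 / _ * _.
have s2M : 0 < Num.sqrt (2 * M) by rewrite sqrtr_gt0 mulr_gt0.
have s2ME : Num.sqrt (2 * M) ^+ 2 = 2 * M by rewrite sqr_sqrtr // mulr_ge0 // ltW.
have sigma0 : 0 <= sigma by rewrite mulr_ge0 ?sqrtr_ge0 // divr_ge0 ?sqrtr_ge0.
have gE := sqr_sqrtr (enorm_ge0 (grad f y)).
have sE : sigma ^+ 2 = M / 2 * enorm (grad f y).
  by rewrite /sigma exprMn expr_div_n gE s2ME; field.
(* At a zero gradient the oracle answers [(0, 0)], and Track 0 stops the run. *)
have [g0|g0] := eqVneq (grad f y) 0.
  have r0 : 0 <= r by rewrite mulr_ge0 ?sqrtr_ge0 // divr_ge0 ?sqrtr_ge0.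
  have := TRo y sigma r sigma0 r0; rewrite g0 eqxx => -> /=; rewrite eqxx.
  exists (y + 0), true, 1%N; split; last by rewrite addr0 g0 enorm0 ltW.
    exists 0%N => //; rewrite /local_detection enorm0 le_min divr_ge0 ?sqrtr_ge0 //=.
      exact: ltW.
    by rewrite mulr_ge0 // ltW.
  by rewrite addn2.
have r0 : 0 < r by rewrite mulr_gt0 ?divr_gt0 // sqrtr_gt0 enorm_gt0.
have srE : sigma = M * r.
  rewrite /sigma /r mulrA; congr (_ * _).
  apply: (mulIf (lt0r_neq0 s2M)); rewrite mulrAC -expr2 s2ME.
  by field; rewrite gt_eqF.
have grE : enorm (grad f y) = 2 * M * r ^+ 2.
  by rewrite exprMn gE expr_div_n s2ME; field; rewrite gt_eqF.
have := TR_oracleP y sigma r sigma0 r0 g0.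
case: (TR y sigma r) => d lambda [dr l0 comp hd].
case: eqP => [l00|/eqP l00].
  rewrite l00 addr0 in hd.
  have hM : M * enorm d <= sigma by rewrite srE ler_pM2l.
  have [x' [et [c [h1 h2 h3]]]] := local_detection_spec y d sigma g0 gG hd hM sE hm0.
  exists x', et, c.+1; split; [by exists c | by rewrite addn2 ltnS -addn1 | by case: et h1 h3].
have dE : enorm d = r.
  by move/eqP: comp; rewrite mulf_eq0 (negbTE l00) /= subr_eq0 => /eqP.
exists (y + d), false, 1%N; split=> //; first by rewrite addn2.
split=> //; exists d, (sigma + lambda); split=> //; first by rewrite dE srE lerDl.
rewrite dE -(ler_pM2r r0).
have -> : 2 * M * r * r = 2 * M * r ^+ 2 by ring.
by rewrite -grE -dE; exact: damped_newton_le.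
Qed.

End Iteration.

End Oracle.

(** * Complexity *)

Section Logarithm.
Context {R : realType}.
Implicit Types x y : R.

(** Spelled as in [diving_steps], so that its lemmas apply there by conversion. *)
Definition natceil x : nat := `|Num.max 0%R (Num.ceil x)|%N.

Lemma natceilE x : (natceil x)%:R = (Num.max 0 (Num.ceil x))%:~R :> R.
Proof. by rewrite natr_absz ger0_norm // le_max lexx. Qed.

Lemma natceil_ge x : x <= (natceil x)%:R.
Proof.
by rewrite natceilE (le_trans (ceil_ge x)) // ler_int le_max lexx orbT.
Qed.

Lemma le_natceil x y : x <= y -> (natceil x <= natceil y)%N.
Proof.
by move=> xy; rewrite -(ler_nat R) !natceilE ler_int ge_max !le_max lexx le_ceil ?orbT.
Qed.

Lemma natceil_le x : 0 <= x -> (natceil x)%:R <= x + 1.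
Proof.
move=> x0; rewrite natceilE; case: (leP 0 (Num.ceil x)) => [c0|c0].
  by have := ceilB1_lt x; rewrite intrB => /ltW; lra.
by lra.
Qed.

Lemma ln2_gt0 : 0 < ln 2 :> R.
Proof. by apply: ln_gt0; lra. Qed.

Lemma log2_ge0 x : 1 <= x -> 0 <= log2 x.
Proof. by move=> x1; apply: divr_ge0; [exact: ln_ge0 | exact: ltW ln2_gt0]. Qed.

Lemma log2_le x y : 0 < x -> x <= y -> log2 x <= log2 y.
Proof.
move=> x0 xy; rewrite ler_pM2r ?invr_gt0 ?ln2_gt0 // ler_ln ?posrE //.
exact: lt_le_trans xy.
Qed.

Lemma log2M x y : 0 < x -> 0 < y -> log2 (x * y) = log2 x + log2 y.
Proof. by move=> x0 y0; rewrite /log2 lnM ?posrE // mulrDl. Qed.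

Lemma log2X x m : 0 < x -> log2 (x ^+ m) = m%:R * log2 x.
Proof. by move=> x0; rewrite /log2 lnXn // mulrA mulr_natl. Qed.

Lemma log2_2 : log2 2 = 1 :> R.
Proof. by rewrite /log2 divff // gt_eqF // ln2_gt0. Qed.

Lemma lt_exp2 x m : 0 < x -> log2 x < m%:R -> x < 2 ^+ m.
Proof.
by move=> x0; rewrite ltr_pdivrMr ?ln2_gt0 // mulr_natl -lnXn // ltr_ln ?posrE.
Qed.

End Logarithm.

(** * Induction over the iterations *)

Section Complexity.
Context {R : realType} {n : nat}.
Variables (f : 'cV[R]_n -> R) (TR : 'cV[R]_n -> R -> R -> 'cV[R]_n * R).
Variables (M kappa D0 eps : R) (x0 xstar : 'cV[R]_n).
Hypotheses (M_gt0 : 0 < M) (kappa_gt0 : 0 < kappa)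
  (f_convex : convex_function [set: convex_lmodType 'cV[R]_n] f)
  (f_smooth : twice_cont_diff f)
  (hess_lip : forall x y, specnorm (hess f x - hess f y) <= M * enorm (x - y))
  (hess_bound : forall x, specnorm (hess f x) <= kappa)
  (xstar_min : forall x, f xstar <= f x)
  (D0E : D0 = enorm (x0 - xstar))
  (TRo : TR_oracle f TR).

Let f_diff x : differentiable f x.
Proof. by case: f_smooth. Qed.

Let grad_diff x : differentiable (grad f) x.
Proof. by case: f_smooth. Qed.

Let grad_le := convex_grad f f_diff f_convex.
Let psd := hess_psd f f_diff grad_diff f_convex.

(* Bounds the gradient at the points [y_k]; the + 1 makes its logarithm
   nonnegative. *)
Definition grad_radius : R := 2 * kappa * (8 * M * D0 ^+ 3 + 2 * kappa * D0 ^+ 2) + 1.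

Lemma D0_ge0 : 0 <= D0.
Proof. by rewrite D0E enorm_ge0. Qed.

Lemma grad_radius_ge1 : 1 <= grad_radius.
Proof.
rewrite /grad_radius lerDr; have := D0_ge0 => d0.
by rewrite mulr_ge0 ?addr_ge0 ?mulr_ge0 ?exprn_ge0 // ltW.
Qed.

(** Both terms of [estimate_gap] at [xstar] are nonnegative; the cube root of 2 is rounded up to
    2. *)
Lemma estimate_gap_min k x v s : estimate f M x0 k x v s ->
  weight k * (f x - f xstar) <= 8 * M * D0 ^+ 3 /\ enorm (v - xstar) <= 2 * D0.
Proof.
move=> est; have := estimate_gap f M x0 M_gt0 _ _ _ _ xstar est.
rewrite (enormB xstar v) (enormB xstar x0) -D0E => h.
have w0 : 0 <= weight k * (f x - f xstar).
  by rewrite mulr_ge0 ?subr_ge0 // divr_ge0.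
have d0 := D0_ge0; have t0 := enorm_ge0 (v - xstar).
split.
  have := mulr_ge0 (ltW M_gt0) (exprn_ge0 3 t0); lra.
rewrite -(@ler_pXn2r _ 3) // ?nnegrE ?mulr_ge0 //.
rewrite -(ler_pM2l M_gt0) exprMn.
have := mulr_ge0 (ltW M_gt0) (exprn_ge0 3 d0).
have -> : (2 : R) ^+ 3 = 8 by ring.
by lra.
Qed.

(** Convexity bounds the gap at [y] by those at [x] and [v], and the gap bounds the gradient. *)
Lemma grad_extrapolation_le k x v s y : estimate f M x0 k x v s ->
  y = (k%:R / (k + 3)%:R) *: x + (3 / (k + 3)%:R) *: v ->
  enorm (grad f y) <= grad_radius.
Proof.
move=> est yE; have [hx hv] := estimate_gap_min _ _ _ _ est.
have d0 := D0_ge0.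
have N0 : 0 < k%:R + 3 :> R by rewrite ltr_wpDl.
have t01 : 0 <= (k%:R / (k + 3)%:R : R) <= 1.
  apply/andP; split; first exact: divr_ge0.
  by rewrite natrD ler_pdivrMr // mul1r lerDl.
have := convex_le f f_convex x v _ t01.
have -> : 1 - k%:R / (k + 3)%:R = 3 / (k + 3)%:R :> R.
  by rewrite natrD; field; rewrite gt_eqF.
rewrite -yE => fy.
(* [k / (k + 3) <= weight k] covers [k = 0] too, where the estimate says nothing about [f x]. *)
have gap_x : k%:R / (k + 3)%:R * (f x - f xstar) <= 8 * M * D0 ^+ 3.
  apply: le_trans hx; rewrite ler_wpM2r ?subr_ge0 //.
  rewrite natrD ler_pdivrMr // /weight !natrM !natrD.
  have k0 : 0 <= k%:R :> R by [].
  have := mulr_ge0 k0 k0; have := mulr_ge0 k0 (mulr_ge0 k0 k0).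
  have := mulr_ge0 (mulr_ge0 k0 k0) (mulr_ge0 k0 k0).
  by move: (k%:R) => q *; lra.
have gap_v : f v - f xstar <= 2 * kappa * D0 ^+ 2.
  have := min_gap_le f f_diff grad_diff kappa xstar kappa_gt0 hess_bound xstar_min v.
  have : enorm (v - xstar) ^+ 2 <= (2 * D0) ^+ 2.
    by rewrite lerXn2r // nnegrE ?enorm_ge0 // mulr_ge0.
  move=> h1 h2; apply: le_trans h2 _.
  have -> : 2 * kappa * D0 ^+ 2 = kappa / 2 * (2 * D0) ^+ 2 by field.
  by rewrite ler_wpM2l // divr_ge0 // ltW.
have t3 : 0 <= (3 / (k + 3)%:R : R) <= 1.
  apply/andP; split; first exact: divr_ge0.
  by rewrite natrD ler_pdivrMr // mul1r lerDr.
have gap_v' : 3 / (k + 3)%:R * (f v - f xstar) <= 2 * kappa * D0 ^+ 2.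
  apply: le_trans gap_v; rewrite -[leRHS]mul1r ler_wpM2r ?subr_ge0 //.
  by case/andP: t3.
have tt : k%:R / (k + 3)%:R + 3 / (k + 3)%:R = 1 :> R.
  by rewrite natrD; field; rewrite gt_eqF.
have gap_y : f y - f xstar <= 8 * M * D0 ^+ 3 + 2 * kappa * D0 ^+ 2.
  have e : f xstar = (k%:R / (k + 3)%:R + 3 / (k + 3)%:R) * f xstar by rewrite tt mul1r.
  move: fy gap_x gap_v' e; move: (k%:R / _) (3 / _) (f x) (f v) (f xstar) (f y).
  by move=> a b p q r u; nra.
have := sqr_enorm_grad_le f f_diff grad_diff kappa xstar kappa_gt0 hess_bound xstar_min y.
have : 2 * kappa * (f y - f xstar) <=
   2 * kappa * (8 * M * D0 ^+ 3 + 2 * kappa * D0 ^+ 2).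
  by rewrite ler_wpM2l // mulr_ge0 // ltW.
move=> h1 h2; have := le_trans h2 h1 => h.
apply: ler_of_sqr; first exact: le_trans grad_radius_ge1.
apply: le_trans h _; have := grad_radius_ge1; rewrite /grad_radius.
by move: (2 * kappa * _) => q; nra.
Qed.

Section Run.
Variables (rho delta : R) (m : nat).
Hypotheses (eps_gt0 : 0 < eps) (eps_le1 : eps <= 1) (eps_small : M * eps <= 2 * kappa ^+ 2)
  (rho_gt0 : 0 < rho)
  (rho_le : rho <= Num.min (eps / (2 * kappa)) (Num.sqrt (eps / M)))
  (delta_le : delta * (kappa * rho + 2 * grad_radius) <= M * rho ^+ 3)
  (m_large : grad_radius / (M * rho) < 2 ^+ m * delta).

(** The 2 counts the call of step (b) and the initial [r_+]. *)
Definition iteration_cost : nat := (natceil (log2 (grad_radius / eps)) + m + 2)%N.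

Lemma diving_steps_le y : enorm (grad f y) <= grad_radius ->
  (diving_steps f eps y <= natceil (log2 (grad_radius / eps)))%N.
Proof.
move=> gG; apply: le_natceil.
(* Here [log2 0 = 0] by convention, while [grad_radius / eps >= 1]. *)
have [->|g0] := eqVneq (grad f y) 0.
  rewrite enorm0 mul0r /log2 ln0 // mul0r log2_ge0 // ler_pdivlMr // mul1r.
  exact: le_trans eps_le1 grad_radius_ge1.
apply: log2_le; first by rewrite divr_gt0 // enorm_gt0.
by rewrite ler_pM2r // invr_gt0.
Qed.

Lemma run_invariant (k : nat) :
  (exists x c, [/\ outputs f TR M kappa eps x0 x c,
     enorm (grad f x) <= eps & (c <= k * iteration_cost)%N]) \/
  (exists x v s c, [/\ produces f TR M kappa eps x0 k x v s c,
     estimate f M x0 k x v s & (c <= k * iteration_cost)%N]).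
Proof.
elim: k => [|k [[x [c [h1 h2 h3]]]|[x [v [s [c [h1 h2 h3]]]]]]].
- right; exists x0, x0, 0, 0%N; split=> //; first exact: produces_init.
  exact: estimate_init.
- by left; exists x, c; split=> //; rewrite (leq_trans h3) // leq_mul2r leqnSn orbT.
have gG := grad_extrapolation_le _ _ _ _ _ h2 erefl.
have [x' [et [c' [it hc' het]]]] := iteration_spec f TR M kappa M_gt0 kappa_gt0 grad_diff
  hess_lip hess_bound psd TRo eps grad_radius rho delta _ m eps_gt0 eps_small rho_gt0
  rho_le delta_le m_large k x v gG (diving_steps_le _ gG).
have hc : (c + c' <= k.+1 * iteration_cost)%N by rewrite mulSn addnC leq_add.
case: et it het => it het.
  by left; exists x', (c + c')%N; split=> //; exists k, x, v, s, c, c'.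
right; exists x'.
pose s' := s + (((k + 1) * (k + 2))%:R / 2) *: grad f x'.
exists (x0 - Num.sqrt (1 / (24 * M * enorm s')) *: s'), s', (c + c')%N.
split; [exact: produces_step h1 it | | exact: hc].
apply: (estimate_step f M x0 M_gt0 grad_le k x v s x') => //.
case: het => g0 acc tau tau0 gE.
exact: (accepted_decrease f TR M M_gt0 grad_diff hess_lip TRo _ _ _ g0 acc tau0 gE).
Qed.

End Run.

End Complexity.

(** * Choice of the constants *)

Section Constants.
Context {R : realType}.

(* Up to the + 1, the width of the first bracket divided by the least possible
   width is at most this constant times [eps ^- 4]. *)
Definition bisection_ratio (M kappa G : R) : R :=
  G * (kappa + 2 * G) / M ^+ 2 * (2 * kappa + M + 1) ^+ 4 + 1.

Lemma bisection_ratio_ge1 M kappa G : 0 < M -> 0 < kappa -> 0 < G ->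
  1 <= bisection_ratio M kappa G.
Proof.
move=> M0 k0 G0; rewrite lerDr.
have kG : 0 <= kappa + 2 * G by lra.
have c0 : 0 <= 2 * kappa + M + 1 by lra.
apply: mulr_ge0; last exact: exprn_ge0.
by apply: divr_ge0; [apply: mulr_ge0 => //; exact: ltW | exact: sqr_ge0].
Qed.

(** [rho] is proportional to [eps], and [delta], of order [eps^3], turns the width condition into an
    equality. The first bracket over [delta] is then of order [eps^-4], and [m] is its logarithm. *)
Lemma bisection_parameters (M kappa G eps : R) :
  0 < M -> 0 < kappa -> 1 <= G -> 0 < eps -> eps <= 1 / 2 ->
  exists rho delta (m : nat), [/\ 0 < rho,
    rho <= Num.min (eps / (2 * kappa)) (Num.sqrt (eps / M)),
    delta * (kappa * rho + 2 * G) <= M * rho ^+ 3,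
    G / (M * rho) < 2 ^+ m * delta
  & (natceil (log2 (G / eps)) + m + 2)%:R <=
    (log2 G + log2 (bisection_ratio M kappa G) + 10) * log2 (1 / eps)].
Proof.
move=> M0 k0 G1 e0 e2.
have G0 : 0 < G by lra.
(* [S >= 2 kappa] and [S^2 >= M] put [eps / S] below both thresholds of Track 0; [S >= 1] gives
   [rho <= 1]. *)
pose S := 2 * kappa + M + 1; pose Q := bisection_ratio M kappa G.
have S0 : 0 < S by rewrite /S; lra.
have Q1 : 1 <= Q by exact: bisection_ratio_ge1.
have [rho rhoE] : exists r, r = eps / S by exists (eps / S).
have rho0 : 0 < rho by rewrite rhoE divr_gt0.
have rho1 : rho <= 1 by rewrite rhoE ler_pdivrMr // mul1r /S; lra.
have p0 : 0 < kappa * rho + 2 * G by apply: addr_gt0; exact: mulr_gt0.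
pose delta := M * rho ^+ 3 / (kappa * rho + 2 * G).
have delta0 : 0 < delta.
  by apply: divr_gt0 => //; apply: mulr_gt0 => //; exact: exprn_gt0.
pose L := log2 (1 / eps).
have ei : 2 <= 1 / eps by rewrite ler_pdivlMr //; lra.
have ei0 : 0 < 1 / eps by lra.
have L1 : 1 <= L by rewrite -(@log2_2 R) log2_le.
have lG0 := log2_ge0 _ G1; have lQ0 := log2_ge0 _ Q1.
have Q0 : 0 < Q by lra.
have lQE : log2 (Q * (1 / eps) ^+ 4) = log2 Q + 4 * L.
  by rewrite log2M ?exprn_gt0 // log2X.
have lGE : log2 (G / eps) = log2 G + L by rewrite -log2M // mul1r.
(* The successor makes the bound by [2 ^+ m] strict. *)
exists rho, delta, (natceil (log2 (Q * (1 / eps) ^+ 4))).+1; split => //.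
- rewrite le_min; apply/andP; split.
    by rewrite rhoE ler_pM2l // lef_pV2 ?posrE ?mulr_gt0 // /S; lra.
  apply: ler_of_sqr; first exact: sqrtr_ge0.
  rewrite sqr_sqrtr; last by rewrite divr_ge0 ?ltW.
  have -> : rho ^+ 2 = eps * (M * eps / S ^+ 2) / M by rewrite rhoE; field; rewrite !gt_eqF.
  rewrite ler_pM2r ?invr_gt0 // -[leRHS]mulr1 ler_pM2l // ler_pdivrMr ?exprn_gt0 // mul1r.
  apply: le_trans (_ : M * 1 <= _); first by rewrite ler_pM2l //; lra.
  apply: le_trans (_ : S * 1 <= _); first by rewrite /S; lra.
  by rewrite expr2 ler_pM2l // /S; lra.
- by rewrite divfK ?gt_eqF.
- rewrite -ltr_pdivrMr //; apply: lt_exp2.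
    by rewrite !divr_gt0 ?mulr_gt0.
  apply: le_lt_trans (_ : _ <= (natceil (log2 (Q * (1 / eps) ^+ 4)))%:R) _; last first.
    by rewrite ltr_nat.
  apply: le_trans (natceil_ge _); apply: log2_le; first by rewrite !divr_gt0 ?mulr_gt0.
  have -> : G / (M * rho) / delta =
      G * (kappa * rho + 2 * G) / M ^+ 2 * S ^+ 4 * (1 / eps) ^+ 4.
    rewrite /delta rhoE; field; rewrite (gt_eqF e0) (gt_eqF M0) (gt_eqF S0) /=.
    by apply/lt0r_neq0; rewrite addr_gt0 ?mulr_gt0.
  rewrite ler_pM2r ?exprn_gt0 // /Q /bisection_ratio -/S.
  apply: le_trans (_ : G * (kappa + 2 * G) / M ^+ 2 * S ^+ 4 <= _); last by lra.
  rewrite ler_pM2r ?exprn_gt0 // ler_pM2r ?invr_gt0 ?exprn_gt0 // ler_pM2l //.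
  by rewrite lerD2r ger_pMr.
(* The count is at most [log2 G + log2 Q + 5 L + 5], and [L >= 1]. *)
rewrite !natrD -natr1.
have n1 : (natceil (log2 (G / eps)))%:R <= log2 G + L + 1.
  by rewrite -lGE; apply: natceil_le; lra.
have n2 : (natceil (log2 (Q * (1 / eps) ^+ 4)))%:R <= log2 Q + 4 * L + 1.
  by rewrite -lQE; apply: natceil_le; lra.
rewrite -/L -/Q; have := mulr_ge0 lG0 (_ : 0 <= L - 1).
by have := mulr_ge0 lQ0 (_ : 0 <= L - 1); rewrite subr_ge0 => /(_ L1) ? /(_ L1) ?; lra.
Qed.

(** [K] is [B e] rounded up, with [e = eps^(-1/3)] and [B = 1 + 6 A]. Then
    [weight K >= B^3 e^3 / 6], where [e^3 eps = 1] and [B^3 >= B]. Rounding costs a factor 2, as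
    [B e >= 1]. *)
Lemma iteration_count (A eps : R) : 0 <= A -> 0 < eps < 1 ->
  exists K : nat, K%:R <= 2 * (1 + 6 * A) * eps `^ (- (1 / 3)) /\
    (0 < weight (R := R) K) && (A <= weight K * eps).
Proof.
move=> A0 /andP[e0 e1]; set e := eps `^ _.
have ee0 : 0 < e by exact: powR_gt0.
have e3 : e ^+ 3 * eps = 1.
  rewrite -powR_mulrn ?(ltW ee0) // -powRrM.
  have -> : - (1 / 3) * 3 = -1 :> R by field.
  by rewrite powR_inv1 ?(ltW e0) // mulVf // gt_eqF.
have e1' : 1 <= e.
  rewrite leNgt; apply/negP => el.
  have : e ^+ 3 < 1 by rewrite exprn_ilt1 // ltW.
  by have := exprn_gt0 3 ee0; nra.
pose B := 1 + 6 * A.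
have B1 : 1 <= B by rewrite /B; lra.
have Be : 1 <= B * e by nra.
exists (natceil (B * e)); rewrite -/B.
have Kl := natceil_ge (B * e).
have Ku : (natceil (B * e))%:R <= B * e + 1 by apply: natceil_le; lra.
split; first by lra.
move: Kl; rewrite /weight !natrM !natrD; move: (natceil _)%:R => K Kl.
have K0 : 0 <= K by lra.
have K3 : (B * e) ^+ 3 <= K ^+ 3 by rewrite lerXn2r // nnegrE //; lra.
have wK : K ^+ 3 / 6 <= K * (K + 1) * (K + 2) / 6.
  by rewrite ler_pM2r //; have := mulr_ge0 K0 K0; nra.
have BB : B <= B ^+ 3 by have := mulr_ge0 (_ : 0 <= B) (_ : 0 <= B); nra.
have h : B <= K ^+ 3 * eps.
  apply: le_trans BB _; apply: le_trans (_ : (B * e) ^+ 3 * eps <= _).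
    by rewrite exprMn -mulrA e3 mulr1.
  by rewrite ler_pM2r.
have K30 : 1 <= K ^+ 3.
  by apply: le_trans K3; rewrite exprn_ege1.
apply/andP; split; first by lra.
have : K ^+ 3 / 6 * eps <= K * (K + 1) * (K + 2) / 6 * eps by rewrite ler_pM2r.
by rewrite /B in h; lra.
Qed.

End Constants.

Theorem theorem3p12 (R : realType) (M kappaH D0 : R)
    (M_gt0 : 0 < M) (kappaH_gt0 : 0 < kappaH) (D0_ge0 : 0 <= D0) :
  exists C ebar : R, [/\ 0 < C, 0 < ebar < 1 &
  forall (n : nat) (f : 'cV[R]_n -> R) (x0 xstar : 'cV[R]_n)
         (TR : 'cV[R]_n -> R -> R -> 'cV[R]_n * R),
    convex_function [set: convex_lmodType 'cV[R]_n] f ->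
    twice_cont_diff f ->
    (forall x y, specnorm (hess f x - hess f y) <= M * enorm (x - y)) ->
    (forall x, f xstar <= f x) ->
    (forall x, specnorm (hess f x) <= kappaH) ->
    D0 = enorm (x0 - xstar) ->
    TR_oracle f TR ->
  forall eps_f eps_g : R, 0 < eps_f < ebar -> 0 < eps_g < ebar ->
  exists c : nat,
    c%:R <= C * eps_f `^ (- (1 / 3)) * log2 (1 / eps_g) /\
    ((exists2 x, outputs f TR M kappaH eps_g x0 x c
               & enorm (grad f x) <= eps_g) \/
     (exists k x v s, produces f TR M kappaH eps_g x0 k x v s c /\
        approx_solution f (f xstar) eps_f eps_g x))].
Proof.
pose G := grad_radius M kappaH D0.
pose C1 := log2 G + log2 (bisection_ratio M kappaH G) + 10.
pose A := 8 * M * D0 ^+ 3.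
have A0 : 0 <= A by rewrite /A !mulr_ge0 ?exprn_ge0 // ltW.
have G1 : 1 <= G.
  rewrite lerDr; apply: mulr_ge0; first by rewrite mulr_ge0 // ltW.
  apply: addr_ge0 => //; apply: mulr_ge0; last exact: sqr_ge0.
  by rewrite mulr_ge0 // ltW.
have C10 : 10 <= C1.
  rewrite /C1 lerDr addr_ge0 // log2_ge0 // bisection_ratio_ge1 //; lra.
(* The bound 1/2 makes [log2 (1 / eps_g)] at least 1; the other one gives [M eps_g <= 2 kappaH^2],
   needed for Track 0. *)
exists (2 * (1 + 6 * A) * C1), (Num.min (1 / 2) (2 * kappaH ^+ 2 / M)); split.
- by rewrite !mulr_gt0 //; lra.
- apply/andP; split; last by rewrite gt_min; apply/orP; left; lra.
  by rewrite lt_min !divr_gt0 ?mulr_gt0 ?exprn_gt0.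
move=> n f x0 xstar TR cvx smooth lip xmin hbound D0E TRo eps_f eps_g.
rewrite !lt_min => /andP[ef0 /andP[ef2 _]] /andP[eg0 /andP[eg2 egM]].
have eg1 : eps_g <= 1 by lra.
have eps_small : M * eps_g <= 2 * kappaH ^+ 2 by rewrite mulrC -ler_pdivlMr // ltW.
have [rho [delta [m [h1 h2 h3 h4 h5]]]] :=
  bisection_parameters _ _ _ _ M_gt0 kappaH_gt0 G1 eg0 (ltW eg2).
have ef01 : 0 < eps_f < 1 by rewrite ef0; lra.
have [K [hK /andP[wK hw]]] := iteration_count A eps_f A0 ef01.
have cost (c : nat) : (c <= K * iteration_cost M kappaH D0 eps_g m)%N ->
    c%:R <= 2 * (1 + 6 * A) * C1 * eps_f `^ (- (1 / 3)) * log2 (1 / eps_g).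
  move=> hc; apply: le_trans (_ : (K * iteration_cost M kappaH D0 eps_g m)%:R <= _).
    by rewrite ler_nat.
  rewrite natrM -/G -/C1 in h5 *.
  apply: le_trans (ler_pM _ _ hK h5) _ => //.
  by rewrite le_eqVlt; apply/orP; left; apply/eqP; ring.
have [[x [c [a1 a2 a3]]]|[x [v [s [c [p1 p2 p3]]]]]] :=
  run_invariant f TR M kappaH D0 eps_g x0 xstar M_gt0 kappaH_gt0 cvx smooth lip
    hbound xmin D0E TRo rho delta m eg0 eg1 eps_small h1 h2 h3 h4 K.
  by exists c; split; [exact: cost | left; exists x].
exists c; split; first exact: cost.
right; exists K, x, v, s; split=> //; left.
have [gap _] := estimate_gap_min f M D0 x0 xstar M_gt0 xmin D0E _ _ _ _ p2.
(* [weight K * (f x - f xstar) <= A <= weight K * eps_f]. *)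
by rewrite -(ler_pM2l wK); exact: le_trans gap hw.
Qed.
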